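(* (a) For every zero-mean generalized Gaussian field $\mathfrak X$ over a Hilbert space $\mathbf H$, there exist a bounded linear operator $\mathcal K$ on $\mathbf H$ and a white noise $\mathfrak B$ over $\mathbf H$ such that $\mathcal K\mathcal K^*$ is the covariance operator of $\mathfrak X$ and, for every $f\in\mathbf H$, $$\mathfrak X(f)=\mathfrak B(\mathcal K^*f),$$ where $\mathcal K^*$ is the adjoint of $\mathcal K$. (b) For every zero-mean non-degenerate generalized Gaussian field $\mathfrak X$ over a Hilbert space $\mathbf H$, there exists a Hilbert space $\mathbf H_{\mathcal R}$ such that $\mathbf H$ is continuously embedded into $\mathbf H_{\mathcal R}$ and $\mathfrak X$ extends to a white noise over $\mathbf H_{\mathcal R}$.
   Context: $(\Omega,\mathcal F,\mathbb P)$ is a probability space assumed rich enough to support all the random elements needed (so, e.g., it carries a white noise over $\mathbf H$ independent of $\mathfrak X$). All Hilbert spaces are real. A zero-mean generalized Gaussian field over a Hilbert space $\mathbf H$ is a map $f\mapsto\mathfrak X(f)$ from $\mathbf H$ to (possibly degenerate) zero-mean Gaussian random variables on $\Omega$ that is linear, $\mathfrak X(\alpha f+\beta g)=\alpha\mathfrak X(f)+\beta\mathfrak X(g)$ for $\alpha,\beta\in\mathbb R$, $f,g\in\mathbf H$, and continuous: $f_n\to f$ in $\mathbf H$ implies $\mathfrak X(f_n)\to\mathfrak X(f)$ in probability. Equalities between random variables are almost sure. The covariance operator of $\mathfrak X$ is the unique bounded self-adjoint linear operator $\mathcal R$ on $\mathbf H$ with $\mathbb E(\mathfrak X(f)\mathfrak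 X(g))=(\mathcal Rf,g)_{\mathbf H}$ for all $f,g\in\mathbf H$. The field is non-degenerate if $\ker(\mathcal R)=0$. A white noise over $\mathbf H$ is a zero-mean generalized Gaussian field over $\mathbf H$ whose covariance operator is the identity. *)

(* Defs.v *)
From HB Require Import structures.
From mathcomp Require Import all_boot all_order all_algebra.
From mathcomp Require Import all_classical all_reals all_analysis.

Set Implicit Arguments.
Unset Strict Implicit.
Unset Printing Implicit Defensive.

Import Order.TTheory GRing.Theory Num.Theory.
Import numFieldNormedType.Exports.

Local Open Scope classical_set_scope.
Local Open Scope ring_scope.

Record hilbertSpace (R : realType) := HilbertSpace {
  hilbert_carrier :> completeNormedModType R;
  hilbert_dot : {dot hilbert_carrier for idfun};
  hilbert_normE : forall x, `|x| ^+ 2 = hilbert_dot x x }.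

Notation "''[' f , g ]" := (hilbert_dot _ f g) : ring_scope.

Section Operators.
Context {R : realType}.

Definition bounded_operator (H H' : hilbertSpace R) (A : {linear H -> H'}) :=
  exists M : R, forall f : H, `|A f| <= M * `|f|.

Definition adjoint_operators (H : hilbertSpace R) (A B : {linear H -> H}) :=
  forall f g : H, '[A f, g] = '[f, B g].

Definition continuous_embedding (H H' : hilbertSpace R)
    (i : {linear H -> H'}) :=
  bounded_operator i /\ injective i.

End Operators.

Section Fields.
Context {R : realType} {d : measure_display} {Omega : measurableType d}.
Variable P : probability Omega R.

(* The degenerate law is treated apart: normal_prob 0 0 is not a Dirac mass
   but the uniform law on [0, 1]. *)
Definition zero_mean_gaussian (Y : {RV P >-> R}) :=
  (forall A : set R, measurable A -> distribution P Y A = \d_(0 : R) A) \/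
  (exists2 s : R, 0 < s &
    forall A : set R, measurable A -> distribution P Y A = normal_prob 0 s A).

Definition cvg_in_probability (Y : nat -> {RV P >-> R}) (Z : {RV P >-> R}) :=
  forall e : R, 0 < e ->
    P [set w | e < `|Y n w - Z w|] @[n --> \oo] --> 0%E.

Definition gaussian_field (H : hilbertSpace R) (X : H -> {RV P >-> R}) :=
  [/\ forall f : H, zero_mean_gaussian (X f),
      forall (a b : R) (f g : H),
        {ae P, forall w, X (a *: f + b *: g) w = a * X f w + b * X g w}
    & forall (u : nat -> H) (f : H),
        u @ \oo --> f -> cvg_in_probability (fun n => X (u n)) (X f)].

(* An extended-real expectation equal to a real number is that of an
   integrable variable, so square integrability is not assumed separately. *)
Definition covariance_operator (H : hilbertSpace R) (X : H -> {RV P >-> R})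
    (A : {linear H -> H}) :=
  [/\ bounded_operator A, adjoint_operators A A
    & forall f g : H, ('E_P[X f \* X g])%E = ('[A f, g])%:E].

Definition nondegenerate_field (H : hilbertSpace R) (X : H -> {RV P >-> R}) :=
  exists2 A : {linear H -> H},
    covariance_operator X A & forall f : H, A f = 0 -> f = 0.

Definition white_noise (H : hilbertSpace R) (B : H -> {RV P >-> R}) :=
  gaussian_field B /\ covariance_operator B idfun.

Definition field_sigma_algebra (H : hilbertSpace R) (X : H -> {RV P >-> R}) :
    set (set Omega) :=
  <<s \bigcup_f preimage_set_system setT (X f) measurable >>.

Definition independent_fields (H H' : hilbertSpace R)
    (X : H -> {RV P >-> R}) (Y : H' -> {RV P >-> R}) :=
  forall A B : set Omega,
    field_sigma_algebra X A -> field_sigma_algebra Y B ->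
    P (A `&` B) = (P A * P B)%E.

Definition carries_independent_white_noise (H : hilbertSpace R)
    (X : H -> {RV P >-> R}) :=
  exists2 W : H -> {RV P >-> R}, white_noise W & independent_fields X W.

End Fields.

(* Main.v *)
Require Import Defs.
From HB Require Import structures.
From mathcomp Require Import all_boot all_order all_algebra.
From mathcomp Require Import all_classical all_reals all_analysis.
From mathcomp Require Import measurable_realfun.
From mathcomp Require Import ring lra.

(** A Gaussian field [X] has a bounded covariance operator [A]: if
   [E (X f)^2 <= C |f|^2] failed for every [C], rescaling would give vectors that
   tend to 0 whose images all have the same normal law, against continuity in
   probability ([gaussian_field_bounded]); Riesz representation then yields [A]
   ([gaussian_field_covariance]). Let [S] be its self-adjoint square root
   ([positive_operator_sqrt]). Then [E (X f * X g) = (S f, S g)], so that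
   [S f |-> X f] is an isometry from the range of [S] into Gaussian variables,
   and the point is to extend it to a white noise on the whole space. Both
   statements hold with [K = Kstar = S] and with [S] as the embedding of [H] into
   a copy of itself.

   The extension ([white_noise_extension]) goes by density: a vector [g] is
   approached fast by vectors where the noise is known, the corresponding
   variables converge almost surely and in mean square, and the limit is Gaussian
   with the right moments. In the non-degenerate case [S] is injective and
   self-adjoint, so its range is dense. In general the orthogonal complement of
   the range is the kernel of [S]; on it the independent white noise [W] is used,
   and the variables [X f + W h], with [S h = 0], realise the isometry on the
   dense set of the vectors [S f + h].

   The facts needed about Gaussian laws are proved with a law written as that of
   [s] times a standard normal variable ([scaled_normal]), which treats degenerate
   laws on the same footing: it is determined by its second moment
   ([scaled_normal_moment]), stable under almost sure limits
   ([scaled_normal_limit]), and stable under independent sums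
   ([scaled_normal_add]), the last from the convolution of normal densities. *)

Set Implicit Arguments.
Unset Strict Implicit.
Unset Printing Implicit Defensive.

Import Order.TTheory GRing.Theory Num.Theory.
Import numFieldNormedType.Exports.

Local Open Scope classical_set_scope.
Local Open Scope ring_scope.

(** * Preliminaries *)

Lemma quadratic_ge0_discr (R : realType) (a b c : R) :
  0 <= c -> (forall t, 0 <= a + 2 * t * b + t ^+ 2 * c) -> b ^+ 2 <= a * c.
Proof.
rewrite le_eqVlt => /predU1P[<-|c0] h.
  have [->|b0] := eqVneq b 0; first by rewrite mulr0 expr0n.
  have := h (- (a + 1) / (2 * b)); rewrite mulr0 addr0.
  have -> : a + 2 * (- (a + 1) / (2 * b)) * b = -1 by field.
  by rewrite ler0N1.
have := h (- b / c).
have -> : a + 2 * (- b / c) * b + (- b / c) ^+ 2 * c = (a * c - b ^+ 2) / c.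
  by field; rewrite gt_eqF.
by rewrite pmulr_lge0 ?invr_gt0// subr_ge0.
Qed.

Lemma is_linearP (R : pzRingType) (U V : lmodType R) (f : U -> V) :
  linear f -> exists F : {linear U -> V}, forall x, F x = f x.
Proof.
move=> lf; pose m := GRing.isLinear.Build _ _ _ _ f lf.
by exists (HB.pack_for {linear U -> V} f m).
Qed.

Lemma cvg_seqP (R : realType) (V : normedModType R) (u : nat -> V) (l : V) :
  u @ \oo --> l <->
  forall e : R, 0 < e -> exists N, forall n, (N <= n)%N -> `|u n - l| <= e.
Proof.
split=> [/cvgrPdist_le h e e0|h].
  have [N _ hN] := h _ e0; exists N => n Nn.
  by rewrite distrC; apply: hN.
apply/cvgrPdist_le => e e0; have [N hN] := h _ e0.
by exists N => // n Nn /=; rewrite distrC; apply: hN.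
Qed.

Lemma cauchy_seq_cvg (R : realType) (V : completeNormedModType R)
    (u : nat -> V) :
  (forall e : R, 0 < e ->
     exists N, forall m n, (N <= m)%N -> (N <= n)%N -> `|u m - u n| <= e) ->
  exists l : V, u @ \oo --> l.
Proof.
move=> h; suff cu : cvgn u by exists (limn u).
apply: cauchy_cvg; apply/cauchy_ballP => e e0.
have e20 : 0 < e / 2 by rewrite divr_gt0.
have [N hN] := h _ e20.
exists (u @` [set n | (N <= n)%N], u @` [set n | (N <= n)%N]) => /=.
  by split; exists N => // n Nn; exists n.
move=> [_ _] [/= [m Nm <-] [n Nn <-]].
rewrite -ball_normE /=; apply: le_lt_trans (hN _ _ Nm Nn) _.
by rewrite ltr_pdivrMr// ltr_pMr// ltr1n.
Qed.

Lemma inv_nat_lt (R : realType) (e : R) : 0 < e ->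
  exists N : nat, forall n, (N <= n)%N -> n.+1%:R^-1 < e.
Proof.
move=> e0; have [N _ hN] := near_infty_natSinv_lt (PosNum e0).
by exists N => n Nn; apply: hN.
Qed.

(** * Inner products and orthogonal representation *)

Section HilbertGeometry.
Context {R : realType} {H : hilbertSpace R}.
Implicit Types x y z : H.

Lemma dotC x y : '[x, y] = '[y, x].
Proof. by rewrite hermC expr0 mul1r. Qed.

Lemma dotDl x y z : '[x + y, z] = '[x, z] + '[y, z].
Proof. by rewrite linearDl. Qed.

Lemma dotDr x y z : '[x, y + z] = '[x, y] + '[x, z].
Proof. by rewrite linearDr. Qed.

Lemma dotZl a x y : '[a *: x, y] = a * '[x, y].
Proof. by rewrite linearZl_LR. Qed.

Lemma dotZr a x y : '[x, a *: y] = a * '[x, y].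
Proof. by rewrite dotC dotZl dotC. Qed.

Lemma dotNl x y : '[- x, y] = - '[x, y].
Proof. by rewrite linearNl. Qed.

Lemma dotNr x y : '[x, - y] = - '[x, y].
Proof. by rewrite linearNr. Qed.

Lemma dotBl x y z : '[x - y, z] = '[x, z] - '[y, z].
Proof. by rewrite dotDl dotNl. Qed.

Lemma dotBr x y z : '[x, y - z] = '[x, y] - '[x, z].
Proof. by rewrite dotDr dotNr. Qed.

Lemma dot0l x : '[0, x] = 0 :> R.
Proof. by rewrite linear0l. Qed.

Lemma dotxx_eq0 x : '[x, x] = 0 -> x = 0.
Proof.
by rewrite -hilbert_normE => /eqP; rewrite expf_eq0/= normr_eq0 => /eqP.
Qed.

Lemma normD_sqr x y : `|x + y| ^+ 2 = `|x| ^+ 2 + 2 * '[x, y] + `|y| ^+ 2.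
Proof. by rewrite !hilbert_normE dotDl !dotDr (dotC y x); ring. Qed.

Lemma normB_sqr x y : `|x - y| ^+ 2 = `|x| ^+ 2 - 2 * '[x, y] + `|y| ^+ 2.
Proof. by rewrite normD_sqr dotNr normrN; ring. Qed.

Lemma dot_le x y : `|'[x, y]| <= `|x| * `|y|.
Proof.
rewrite -ler_sqr ?nnegrE ?mulr_ge0// exprMn real_normK ?num_real//.
apply: quadratic_ge0_discr (sqr_ge0 _) _ => t.
have -> : `|x| ^+ 2 + 2 * t * '[x, y] + t ^+ 2 * `|y| ^+ 2 =
          `|x + t *: y| ^+ 2.
  by rewrite normD_sqr dotZr normrZ exprMn real_normK ?num_real//; ring.
exact: sqr_ge0.
Qed.

Lemma cvg_dotl (u : nat -> H) l x :
  u @ \oo --> l -> '[u n, x] @[n --> \oo] --> '[l, x].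
Proof.
move=> /cvg_seqP ul; apply/cvg_seqP => e e0.
have e1 : 0 < e / (`|x| + 1) by rewrite divr_gt0// ltr_wpDl.
have [N hN] := ul _ e1; exists N => n /hN h.
rewrite -dotBl (le_trans (dot_le _ _))//.
have x1 : 0 < `|x| + 1 by rewrite ltr_wpDl.
move: h; rewrite ler_pdivlMr// => h; apply: le_trans h.
by rewrite ler_wpM2l// lerDl.
Qed.

(** Minimise [|x|^2 - 2 l x] over [M]. By the parallelogram identity a minimising
   sequence is Cauchy, and the limit represents [l] because it is a critical
   point. It lies in the closure of [M], hence the sequence [u]. With [M] the
   whole space this is Riesz representation; with [M] the range of an operator
   and [l] the product with a fixed vector it is an orthogonal projection. *)
Lemma subspace_representation (M : set H) (l : H -> R) (C : R) :
    M 0 -> (forall a x y, M x -> M y -> M (a *: x + y)) ->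
    (forall a x y, M x -> M y -> l (a *: x + y) = a * l x + l y) ->
    (forall x, M x -> `|l x| <= C * `|x|) ->
  exists v, (forall x, M x -> '[v, x] = l x) /\
    exists u : nat -> H, (forall n, M (u n)) /\ u @ \oo --> v.
Proof.
move=> M0 Mlin llin lC.
have l0 : l 0 = 0.
  by have := llin (-1) _ _ M0 M0; rewrite scaler0 addr0 mulN1r addNr.
have MZ a x : M x -> M (a *: x).
  by move=> Mx; rewrite -[_ *: _]addr0; apply: Mlin.
have lZ a x : M x -> l (a *: x) = a * l x.
  by move=> Mx; rewrite -[_ *: _]addr0 llin// l0 addr0.
pose J x : R := `|x| ^+ 2 - 2 * l x.
have J_ge x : M x -> - C ^+ 2 <= J x.
  move=> /lC lx; rewrite /J -subr_ge0 opprK.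
  have := ler_norm (l x); have := sqr_ge0 (`|x| - C); nra.
have infJ : has_inf (J @` M).
  split; first by exists (J 0), 0.
  by exists (- C ^+ 2) => _ [x Mx <-]; exact: J_ge.
pose m := inf (J @` M).
have m_le x : M x -> m <= J x.
  by move=> Mx; apply: inf_lbound; [case: infJ|exists x].
have approx n : exists x, M x /\ J x < m + n.+1%:R^-1.
  have [|_ [x Mx <-] xm] := inf_adherent _ infJ (eps := n.+1%:R^-1).
    by rewrite invr_gt0.
  by exists x.
have [u uP] := choice approx.
have Mu n : M (u n) by case: (uP n).
have uJ n : J (u n) < m + n.+1%:R^-1 by case: (uP n).
have cauchy i j : `|u i - u j| ^+ 2 <= 2 * i.+1%:R^-1 + 2 * j.+1%:R^-1.
  rewrite normB_sqr; have := m_le _ (MZ 2^-1 _ (Mlin 1 _ _ (Mu i) (Mu j))).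
  rewrite /J lZ ?llin//; last exact: Mlin.
  rewrite normrZ exprMn scale1r normD_sqr mul1r.
  rewrite real_normK ?num_real//.
  have := uJ i; have := uJ j; rewrite /J.
  have -> : 2^-1 ^+ 2 = 4^-1 :> R by field.
  move: (i.+1%:R^-1) (j.+1%:R^-1) => ei ej; lra.
have [v uv] : exists v : H, u @ \oo --> v.
  apply: cauchy_seq_cvg => e e0.
  have [N hN] := @inv_nat_lt R (e ^+ 2 / 4) ltac:(by rewrite divr_gt0// exprn_gt0).
  exists N => i j /hN iN /hN jN.
  rewrite -ler_sqr ?nnegrE//; last exact: ltW.
  move: iN jN (cauchy i j).
  move: (i.+1%:R^-1) (j.+1%:R^-1) (`|_| ^+ 2) => ei ej w; lra.
exists v; split; last by exists u.
move=> x Mx; apply: subr0_eq.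
(* [v] is critical: the functional at [u n + t x] is at least the infimum. *)
have key (t : R) : 0 <= 2 * t * ('[v, x] - l x) + t ^+ 2 * `|x| ^+ 2.
  have c1 : 2 * t * ('[u n, x] - l x) + t ^+ 2 * `|x| ^+ 2 + n.+1%:R^-1
      @[n --> \oo] --> 2 * t * ('[v, x] - l x) + t ^+ 2 * `|x| ^+ 2 + 0.
    apply: cvgD; last exact: cvg_harmonic.
    apply: cvgD; last exact: cvg_cst.
    apply: cvgM; first exact: cvg_cst.
    by apply: cvgB; [exact: cvg_dotl|exact: cvg_cst].
  rewrite -[leRHS]addr0; apply: cvgr_to_ge c1 _; near=> n.
  have := m_le _ (Mlin t _ _ Mx (Mu n)); have := uJ n.
  rewrite /J llin// normD_sqr normrZ exprMn dotZl real_normK ?num_real//.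
  rewrite (dotC x); move: (n.+1%:R^-1) => en; lra.
have := quadratic_ge0_discr (sqr_ge0 `|x|) (a := 0) (b := '[v, x] - l x).
rewrite mul0r => /(_ _)/wrap[t|h]; first by rewrite add0r key.
by apply/eqP; rewrite -sqrf_eq0 eq_le sqr_ge0 h.
Unshelve. all: by end_near. Qed.

End HilbertGeometry.

(** * Square roots of positive operators *)

Section OperatorTheory.
Context {R : realType} {H : hilbertSpace R}.
Implicit Types x y z : H.

Lemma riesz_operator (c : H -> H -> R) (C : R) :
    (forall f g, c f g = c g f) ->
    (forall a f g h, c (a *: f + g) h = a * c f h + c g h) ->
    (forall f g, `|c f g| <= C * `|f| * `|g|) ->
  exists A : {linear H -> H},
    bounded_operator A /\ forall f g, '[A f, g] = c f g.
Proof.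
move=> csym clin cC.
have rep f : exists v, forall g, '[v, g] = c f g.
  have [||||v [vc _]] := @subspace_representation R H setT (c f) (C * `|f|) => //.
  - by move=> a g h _ _; rewrite csym clin (csym g) (csym h).
  - by exists v => g; exact: vc.
have [A AP] := choice rep.
have [|A' A'E] := @is_linearP R H H A.
  move=> a f g; apply: subr0_eq; apply: dotxx_eq0.
  set w := A _ - _; by rewrite {1}/w dotBl dotDl dotZl !AP clin subrr.
exists A'; split; last by move=> f g; rewrite A'E AP.
exists C => f; rewrite A'E.
have [->|Af0] := eqVneq (A f) 0.
  have [->|f0] := eqVneq f 0; first by rewrite !normr0 mulr0.
  rewrite normr0 -(@pmulr_lge0 _ `|f|) ?normr_gt0//.
  exact: le_trans (cC f f).
rewrite -(@ler_pM2r _ `|A f|) ?normr_gt0//.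
apply: le_trans (cC _ _); rewrite -AP -expr2 hilbert_normE; exact: ler_norm.
Qed.

(** For a self-adjoint operator the orthogonal complement of the range is the
   kernel, so [h] splits into a vector [q] of the kernel and a limit of vectors
   of the range. *)
Lemma kernel_projection (S : {linear H -> H}) : adjoint_operators S S ->
  forall h, exists q, S q = 0 /\
    exists u : nat -> H, S (u n) @[n --> \oo] --> h - q.
Proof.
move=> Ssym h.
have [||||v [vh [u [uS uv]]]] :=
    @subspace_representation R H [set S x | x in setT] (fun x => '[h, x]) `|h|.
- by exists 0; rewrite ?linear0.
- move=> a _ _ [x _ <-] [y _ <-]; exists (a *: x + y) => //.
  by rewrite linearP.
- by move=> a x y _ _; rewrite dotDr dotZr.
- by move=> x _; exact: dot_le.
exists (h - v); split.
  apply: dotxx_eq0; rewrite Ssym dotBl vh ?subrr//.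
have /choice[w wu] : forall n, exists x, S x = u n.
  by move=> n; have [x _ xu] := uS n; exists x.
by exists w; rewrite subKr; under eq_fun do rewrite wu.
Qed.

(** A positive form obeys its own Cauchy-Schwarz inequality, and applying it to
   the pair (x, A x) turns the bound on the quadratic form into one on the
   operator. *)
Lemma positive_operator_norm_le1 (A : {linear H -> H}) :
    adjoint_operators A A -> (forall x, 0 <= '[A x, x] <= `|x| ^+ 2) ->
  forall x, `|A x| <= `|x|.
Proof.
move=> Asym Apos x.
have [->|Ax0] := eqVneq (A x) 0; first by rewrite normr0.
have posA y : 0 <= '[A y, y] by case/andP: (Apos y).
have cs y : '[A x, y] ^+ 2 <= '[A x, x] * '[A y, y].
  apply: quadratic_ge0_discr => // t.
  have -> : '[A x, x] + 2 * t * '[A x, y] + t ^+ 2 * '[A y, y] =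
            '[A (x + t *: y), x + t *: y].
    by rewrite [A (x + _)]linearD [A (t *: _)]linearZ/= dotDl !dotDr
      !dotZl !dotZr (Asym y) (dotC y); ring.
  exact: posA.
have Ax2 : 0 < `|A x| ^+ 2 by rewrite exprn_gt0// normr_gt0.
rewrite -ler_sqr ?nnegrE// -(ler_pM2r Ax2).
have := cs (A x); rewrite -hilbert_normE expr2 => /le_trans; apply.
by apply: ler_pM => //; [case/andP: (Apos x)|case/andP: (Apos (A x))].
Qed.

Lemma cvg_unique_norm (u : nat -> H) (l l' : H) :
  u @ \oo --> l -> u @ \oo --> l' -> l = l'.
Proof. exact: (@cvg_unique _ (@norm_hausdorff _ H)). Qed.

(** The iteration [sqrt_iter] on the scalar [B = 1]: the majorant of all the
   operator norms below. *)
Fixpoint sqrt_scalar (n : nat) : R :=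
  if n is n'.+1 then 2^-1 * (1 + sqrt_scalar n' ^+ 2) else 0.

(** With [B] the operator [I - A], a fixed point [Y] of this iteration satisfies
   [(I - Y)^2 = A]. *)
Fixpoint sqrt_iter (B : {linear H -> H}) (n : nat) : {linear H -> H} :=
  if n is n'.+1 then
    2^-1 \*: (B \+ (sqrt_iter B n' \o sqrt_iter B n'))
  else \0.

Lemma sqrt_scalar_itv n : 0 <= sqrt_scalar n <= 1.
Proof. by elim: n => [|n /=]; [rewrite /= lexx ler01|nra]. Qed.

Lemma sqrt_scalar_nd m n : (m <= n)%N -> sqrt_scalar m <= sqrt_scalar n.
Proof.
elim: n => [|n IH]; first by rewrite leqn0 => /eqP ->.
rewrite leq_eqVlt => /predU1P[->//|]; rewrite ltnS => /IH /le_trans; apply.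
elim: n {IH} => [|n /= IH]; first by rewrite /=; lra.
by rewrite ler_pM2l ?invr_gt0// lerD2l ler_sqr ?nnegrE//;
  have /andP[] := sqrt_scalar_itv n; have /andP[] := sqrt_scalar_itv n.+1.
Qed.

Lemma sqrt_iterS B n x :
  sqrt_iter B n.+1 x = 2^-1 *: (B x + sqrt_iter B n (sqrt_iter B n x)).
Proof. by []. Qed.

Section SqrtIteration.
Variable B : {linear H -> H}.
Hypothesis B_le1 : forall x, `|B x| <= `|x|.
Let Y := sqrt_iter B.
Let y := sqrt_scalar.

Lemma sqrt_iter_norm n x : `|Y n x| <= y n * `|x|.
Proof.
elim: n x => [|n IH] x; first by rewrite /= normr0 mul0r.
rewrite /Y sqrt_iterS normrZ ger0_norm ?invr_ge0//= -mulrA ler_pM2l ?invr_gt0//.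
rewrite (le_trans (ler_normD _ _))// mulrDl mul1r lerD// expr2 -mulrA.
rewrite (le_trans (IH _))// ler_wpM2l//.
by case/andP: (sqrt_scalar_itv n).
Qed.

(** The increments are dominated by those of the scalar iteration: split
   [Y_(n+1)^2 - Y_n^2] as [Y_(n+1) (Y_(n+1) - Y_n) + (Y_(n+1) - Y_n) Y_n]. *)
Lemma sqrt_iter_incr n x : `|Y n.+1 x - Y n x| <= (y n.+1 - y n) * `|x|.
Proof.
elim: n x => [|n IH] x.
  have Y0 : Y 0 x = 0 by [].
  have y0 : y 0 = 0 by [].
  by rewrite Y0 y0 !subr0; exact: sqrt_iter_norm.
have -> : Y n.+2 x - Y n.+1 x =
    2^-1 *: (Y n.+1 (Y n.+1 x - Y n x) + (Y n.+1 (Y n x) - Y n (Y n x))).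
  transitivity (2^-1 *: (B x + Y n.+1 (Y n.+1 x)) -
                2^-1 *: (B x + Y n (Y n x))) => //.
  rewrite [Y n.+1 (_ - _)]linearB.
  by rewrite -scalerBr opprD addrACA subrr add0r addrA subrK.
rewrite normrZ ger0_norm ?invr_ge0//.
have yS k : y k.+1 = 2^-1 * (1 + y k ^+ 2) by [].
have -> : (y n.+2 - y n.+1) * `|x| =
    2^-1 * (y n.+1 * ((y n.+1 - y n) * `|x|) + (y n.+1 - y n) * (y n * `|x|)).
  by rewrite (yS n.+1) [X in _ - X]yS; ring.
rewrite ler_pM2l ?invr_gt0// (le_trans (ler_normD _ _))// lerD//.
  rewrite (le_trans (sqrt_iter_norm _ _))// ler_wpM2l//.
  by case/andP: (sqrt_scalar_itv n.+1).
rewrite (le_trans (IH _))// ler_wpM2l//; last exact: sqrt_iter_norm.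
by rewrite subr_ge0 sqrt_scalar_nd.
Qed.

Lemma sqrt_iter_dist m n x : (m <= n)%N ->
  `|Y n x - Y m x| <= (y n - y m) * `|x|.
Proof.
elim: n => [|n IH]; first by rewrite leqn0 => /eqP ->; rewrite !subrr normr0 mul0r.
rewrite leq_eqVlt => /predU1P[->|]; first by rewrite !subrr normr0 mul0r.
rewrite ltnS => /IH h.
rewrite -[Y n.+1 x](subrK (Y n x)) -addrA (le_trans (ler_normD _ _))//.
have := sqrt_iter_incr n x; move: h; rewrite !mulrBl; lra.
Qed.

Lemma sqrt_scalar_cvg : exists l : R, y @ \oo --> l.
Proof.
suff cu : cvgn y by exists (limn y).
apply: nondecreasing_is_cvgn; first by move=> m n; exact: sqrt_scalar_nd.
by exists 1 => _ [n _ <-]; case/andP: (sqrt_scalar_itv n).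
Qed.

Lemma sqrt_iter_cvg x : exists l : H, Y n x @[n --> \oo] --> l.
Proof.
have [l /cvg_seqP yl] := sqrt_scalar_cvg.
apply: cauchy_seq_cvg => e e0.
have x1 : 0 < `|x| + 1 by rewrite ltr_wpDl.
have [N hN] := yl (e / (`|x| + 1) / 2) ltac:(by rewrite !divr_gt0).
exists N => m n; wlog mn : m n / (m <= n)%N.
  move=> W Nm Nn; have [|/ltnW] := leqP m n; first by move=> /W; apply.
  by rewrite distrC => /W; apply.
move=> /hN ym /hN yn; rewrite distrC (le_trans (sqrt_iter_dist _ mn))//.
have y2 : y n - y m <= e / (`|x| + 1).
  by move: ym yn; rewrite !ler_norml; lra.
have y0 : 0 <= y n - y m by rewrite subr_ge0 sqrt_scalar_nd.
move: y2; rewrite ler_pdivlMr//; nra.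
Qed.

Lemma sqrt_iter_sym n : adjoint_operators B B -> adjoint_operators (Y n) (Y n).
Proof.
move=> Bsym; elim: n => [|n IH] f g.
  by rewrite /= dot0l dotC dot0l.
by rewrite /Y !sqrt_iterS dotZl dotZr dotDl dotDr Bsym !IH.
Qed.

End SqrtIteration.

(** The iteration on [B = I - A] converges pointwise, since its increments are
   bounded by those of a bounded monotone scalar sequence; the square root is
   [I - Y] for the limit [Y]. *)
Lemma positive_contraction_sqrt (A : {linear H -> H}) :
    adjoint_operators A A -> (forall x, 0 <= '[A x, x] <= `|x| ^+ 2) ->
  exists S : {linear H -> H},
    [/\ bounded_operator S, adjoint_operators S S & forall x, S (S x) = A x].
Proof.
move=> Asym Apos.
have [|B BE] := @is_linearP R H H (fun x => x - A x).
  by move=> a f g; rewrite linearP opprD scalerBr addrACA.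
have Bsym : adjoint_operators B B.
  by move=> f g; rewrite !BE dotBl dotBr Asym.
have B_le1 : forall x, `|B x| <= `|x|.
  apply: positive_operator_norm_le1 => // x.
  by rewrite BE dotBl -hilbert_normE; have := Apos x; lra.
have [Y YP] := choice (sqrt_iter_cvg B_le1).
have Y_cvg (x : H) : sqrt_iter B n x @[n --> \oo] --> Y x by exact: YP.
have [|Y' Y'E] := @is_linearP R H H Y.
  move=> a f g; apply: (cvg_unique_norm (Y_cvg (a *: f + g))).
  under eq_fun do rewrite linearP.
  by apply: cvgD => //; apply: cvgZr.
have Y_le1 x : `|Y x| <= `|x|.
  have c : `|sqrt_iter B n x| @[n --> \oo] --> `|Y x| by exact: cvg_norm.
  have le n : `|sqrt_iter B n x| <= `|x|.
    rewrite (le_trans (sqrt_iter_norm B_le1 _ _))// ler_piMl//.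
    by case/andP: (sqrt_scalar_itv n).
  by apply: cvgr_to_le c _; exact: nearW.
have Ysym f g : '[Y f, g] = '[f, Y g].
  have c1 : '[sqrt_iter B n f, g] @[n --> \oo] --> '[Y f, g].
    exact: cvg_dotl.
  have c2 : '[sqrt_iter B n g, f] @[n --> \oo] --> '[Y g, f].
    exact: cvg_dotl.
  rewrite [RHS]dotC; apply: (cvg_unique _ c1) => //.
  apply: cvg_trans c2; apply: near_eq_cvg; near=> n.
  by rewrite dotC sqrt_iter_sym.
have Yfix x : Y x = 2^-1 *: (B x + Y (Y x)).
  have c1 : sqrt_iter B n.+1 x @[n --> \oo] --> Y x 
    by rewrite (cvg_shiftS (fun n => sqrt_iter B n x)).
  apply: (cvg_unique_norm c1).
  under eq_fun do rewrite sqrt_iterS.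
  apply: cvgZr; apply: cvgD; first exact: cvg_cst.
  have -> : (fun n => sqrt_iter B n (sqrt_iter B n x)) =
      (fun n => sqrt_iter B n (Y x) + sqrt_iter B n (sqrt_iter B n x - Y x)).
    by apply/funext => n; rewrite [sqrt_iter B n (_ - _)]linearB addrC subrK.
  rewrite -[X in _ --> X]addr0; apply: cvgD; first exact: Y_cvg.
  apply/cvg_seqP => e e0; have /cvg_seqP/(_ e e0)[N hN] := Y_cvg x.
  exists N => n /hN h; rewrite subr0 (le_trans (sqrt_iter_norm B_le1 _ _))//.
  rewrite (le_trans _ h)// ler_piMl//.
  by case/andP: (sqrt_scalar_itv n).
have [|S SE] := @is_linearP R H H (fun x => x - Y x).
  by move=> a f g; rewrite -!Y'E linearP opprD scalerBr addrACA.
exists S; split.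
- exists 2 => f; rewrite SE (le_trans (ler_normB _ _))//.
  by have := Y_le1 f; lra.
- by move=> f g; rewrite !SE dotBl dotBr Ysym.
- move=> x; rewrite !SE -!Y'E linearB !Y'E.
  have : Y x + Y x = B x + Y (Y x).
    by rewrite {1 2}Yfix -scalerDl (_ : 2^-1 + 2^-1 = 1 :> R) ?scale1r//; field.
  rewrite BE => h.
  have -> : Y (Y x) = Y x + Y x - (x - A x) by rewrite h addrC addKr.
  set c := x - A x; rewrite opprB.
  by rewrite [_ - c - _]addrAC addrK addrA subrK /c subKr.
Unshelve. all: by end_near. Qed.

Lemma positive_operator_sqrt (A : {linear H -> H}) :
    bounded_operator A -> adjoint_operators A A -> (forall x, 0 <= '[A x, x]) ->
  exists S : {linear H -> H},
    [/\ bounded_operator S, adjoint_operators S S & forall x, S (S x) = A x].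
Proof.
move=> [M AM] Asym Apos.
(* The added 1 keeps the rescaling constant away from 0. *)
pose m := `|M| + 1; have m0 : 0 < m by rewrite ltr_wpDl.
have [|A1 A1E] := @is_linearP R H H (fun x => m^-1 *: A x).
  by move=> a f g; rewrite linearP scalerDr !scalerA mulrC.
have [||S [[C SC] Ssym SS]] := @positive_contraction_sqrt A1.
- by move=> f g; rewrite !A1E dotZl dotZr Asym.
- move=> x; rewrite A1E dotZl mulr_ge0 ?invr_ge0 ?(ltW m0)//=.
  rewrite ler_pdivrMl// (le_trans (ler_norm _))// (le_trans (dot_le _ _))//.
  rewrite expr2 mulrA ler_wpM2r// (le_trans (AM x))// ler_wpM2r//.
  by rewrite /m; have := ler_norm M; lra.
have [|T TE] := @is_linearP R H H (fun x => Num.sqrt m *: S x).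
  by move=> a f g; rewrite linearP scalerDr !scalerA mulrC.
exists T; split.
- exists (Num.sqrt m * C) => f.
  by rewrite TE normrZ ger0_norm// -mulrA ler_wpM2l.
- by move=> f g; rewrite !TE dotZl dotZr Ssym.
- move=> x; rewrite !TE linearZ SS A1E !scalerA -expr2 sqr_sqrtr ?(ltW m0)//.
  by rewrite mulfV ?scale1r// gt_eqF.
Qed.

End OperatorTheory.

(** * Densities and affine changes of variables *)

(** The image of a measure by a map known to be measurable through a
   hypothesis rather than through its type. *)
Definition image_measure {d d'} {T : measurableType d} {T' : measurableType d'}
    {R : realType} (mu : {measure set T -> \bar R}) (f : T -> T')
    (mf : measurable_fun setT f) : {measure set T' -> \bar R} :=
  measure_function_pushforward__canonical__measure_function_Measure mu mf.

Section AffineSubstitution.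
Context {R : realType}.
Local Notation lam := (@lebesgue_measure R).
Local Open Scope ereal_scope.

(** The right-hand side is a measure in [A] that agrees with Lebesgue measure on
   half-open intervals. *)
Lemma lebesgue_affine_preimage (c b : R) (A : set R) : (0 < c)%R ->
  measurable A -> lam A = c%:E * lam ((fun x : R => c * x + b)%R @^-1` A).
Proof.
move=> c0 mA.
have mphi : measurable_fun [set: measurableTypeR R]
    (fun x : measurableTypeR R => c * x + b : measurableTypeR R)%R.
  by apply: measurable_funD => //; exact: measurable_funM.
pose m : {measure set (measurableTypeR R) -> \bar R} :=
  mscale (NngNum (ltW c0)) (image_measure lam mphi).
rewrite -[RHS]/(m A); apply: lebesgue_measure_unique => // _ [[x y]] _ <- /=.
rewrite /m/= /mscale/= /pushforward/=.
have -> : (fun x : R => c * x + b)%R @^-1` `]x, y]%classic =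
    `]((x - b) / c)%R, ((y - b) / c)%R]%classic :> set R.
  apply/seteqP; split => z /=; rewrite !in_itv/= => /andP[];
    by rewrite ?ltr_pdivrMr ?ler_pdivlMr// ltrBlDr lerBrDr (mulrC z) => -> ->.
rewrite !lebesgue_measure_itv/= !lte_fin ltr_pM2r ?invr_gt0// ltrD2r.
case: ifPn => [xy|]; last by rewrite mule0.
by rewrite -!EFinB -EFinM; congr EFin; field; rewrite gt_eqF.
Qed.

Lemma ge0_integral_affine (c b : R) (f : R -> \bar R) : (0 < c)%R ->
    measurable_fun setT f -> (forall x, 0 <= f x) ->
  \int[lam]_x f x = c%:E * \int[lam]_x f (c * x + b)%R.
Proof.
move=> c0 mf f0.
have mphi : measurable_fun [set: measurableTypeR R]
    (fun x : measurableTypeR R => c * x + b : measurableTypeR R)%R.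
  by apply: measurable_funD => //; exact: measurable_funM.
pose m : {measure set (measurableTypeR R) -> \bar R} :=
  mscale (NngNum (ltW c0)) (image_measure lam mphi).
transitivity (\int[m]_x f x).
  by apply: eq_measure_integral => //= A mA _; exact: lebesgue_affine_preimage.
by rewrite ge0_integral_mscale// ge0_integral_pushforward.
Qed.

End AffineSubstitution.

Section NormalDensity.
Context {R : realType}.
Local Notation lam := (@lebesgue_measure R).
Local Open Scope ereal_scope.
Import HBNNSimple.

(** Integration against a measure with a density, by approximating [f] from below
   by simple functions. *)
Lemma ge0_integral_normal_prob (m s : R) (f : R -> \bar R) :
    measurable_fun setT f -> (forall x, 0 <= f x) ->
  \int[normal_prob m s]_x f x = \int[lam]_x (f x * (normal_pdf m s x)%:E).
Proof.
move=> mf f0.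
have mp : measurable_fun setT (EFin \o normal_pdf m s).
  by apply/measurable_EFinP; exact: measurable_normal_pdf.
have p0 x : 0 <= (normal_pdf m s x)%:E by rewrite lee_fin normal_pdf_ge0.
pose f_ := nnsfun_approx (@measurableT _ (measurableTypeR R)) mf.
have f_cvg x : (f_ n x)%:E @[n --> \oo] --> f x.
  by apply: cvg_nnsfun_approx => // *; apply: f0.
have f_nd x : {homo (fun n => (f_ n x)%:E) : a b / (a <= b)%N >-> a <= b}.
  by move=> a b ab; rewrite lee_fin; exact/lefP/nd_nnsfun_approx.
transitivity (limn (fun n => \int[normal_prob m s]_x (f_ n x)%:E)).
  rewrite -monotone_convergence//.
  - by apply: eq_integral => x _; apply/esym/cvg_lim => //; exact: f_cvg.
  - by move=> n; exact/measurable_EFinP/measurable_funP.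
  - by move=> n x _; rewrite lee_fin.
have -> : (fun n => \int[normal_prob m s]_x (f_ n x)%:E) =
    (fun n => \int[lam]_x ((f_ n x)%:E * (normal_pdf m s x)%:E)).
  apply/funext => n.
  under eq_integral do rewrite fimfunE -fsumEFin//.
  rewrite ge0_integral_fsum//; last 2 first.
  - by move=> y; exact/measurable_EFinP/measurable_funM.
  - by move=> y x _; rewrite nnfun_muleindic_ge0.
  have -> : \int[lam]_x ((f_ n x)%:E * (normal_pdf m s x)%:E) =
     \int[lam]_x (\sum_(k \in range (f_ n))
        (k * \1_(f_ n @^-1` [set k]) x)%:E * (normal_pdf m s x)%:E).
    apply: eq_integral => x _; rewrite fimfunE -fsumEFin// ge0_mule_fsuml//.
    by move=> k; rewrite nnfun_muleindic_ge0.
  rewrite ge0_integral_fsum//; last 2 first.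
  - move=> y; apply: emeasurable_funM => //.
    by apply/measurable_EFinP/measurable_funM.
  - by move=> y x _; rewrite mule_ge0// nnfun_muleindic_ge0.
  apply: eq_fsbigr => r _.
  rewrite integralZl_indic_nnsfun// integral_indic// setIT.
  set A := f_ n @^-1` [set r].
  have mA : measurable A by exact: measurable_sfunP.
  have [r0|r0] := ltP r 0%R.
    have -> : A = set0 by exact: preimage_nnfun0.
    rewrite measure0 mule0 integral0_eq// => x _.
    by rewrite indic0 mulr0 mul0e.
  transitivity (r%:E * \int[lam]_(x in A) (normal_pdf m s x)%:E) => //.
  under [RHS]eq_integral do rewrite EFinM -muleA muleC.
  rewrite ge0_integralZr//; last 2 first.
  - apply: emeasurable_funM => //.
    by apply/measurable_EFinP; exact: measurable_indic.
  - by move=> x _; rewrite mule_ge0// lee_fin.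
  rewrite muleC [in LHS]integral_mkcond; congr (_ * _).
  apply: eq_integral => x _; rewrite patchE indicE muleC.
  by case: ifPn => _; rewrite ?mule1 ?mule0.
rewrite -monotone_convergence//.
- apply: eq_integral => x _; apply/cvg_lim => //.
  by apply: cvgeZr => //; exact: f_cvg.
- by move=> n; apply: emeasurable_funM => //; exact/measurable_EFinP/measurable_funP.
- by move=> n x _; rewrite mule_ge0// lee_fin.
- by move=> x _ a b ab; rewrite lee_wpmul2r// f_nd.
Qed.

End NormalDensity.

(** * The standard normal law *)

Section ScaledNormal.
Context {R : realType}.
Local Notation lam := (@lebesgue_measure R).

Definition outside (e : R) : set R := [set x | e < `|x|].

Lemma measurable_outside (e : R) : measurable (outside e).
Proof.
have := @normr_measurable R setT measurableT `]e, +oo[%classic (measurable_itv _).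
rewrite setTI; congr measurable.
by apply/seteqP; split => x /=; rewrite in_itv/= andbT.
Qed.

Lemma measurable_scale (s : R) :
  measurable_fun [set: measurableTypeR R]
    (fun x : measurableTypeR R => s * x : measurableTypeR R).
Proof. exact: measurable_funM. Qed.

Lemma measurable_scale_preimage (s : R) (A : set R) : measurable A ->
  measurable ((fun x : R => s * x) @^-1` A).
Proof. by move=> mA; rewrite -[X in measurable X]setTI; exact: measurable_scale. Qed.

Lemma normal_pdf_scale (s x : R) : 0 < s ->
  s * normal_pdf 0 s (s * x) = normal_pdf 0 1 x.
Proof.
move=> s0; rewrite !normal_pdfE ?gt_eqF// /normal_peak /normal_fun !subr0.
rewrite -[s ^+ 2 * pi *+ 2]mulrnAr sqrtrM ?sqr_ge0// sqrtr_sqr gtr0_norm//.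
rewrite invfM !mulrA mulfV ?gt_eqF// mul1r expr1n mul1r.
congr (_ * expR _); rewrite exprMn; field.
by rewrite gt_eqF.
Qed.

Lemma normal_prob_scale (s : R) (A : set R) : 0 < s -> measurable A ->
  normal_prob 0 s A = normal_prob 0 1 ((fun x : R => s * x) @^-1` A).
Proof.
move=> s0 mA; rewrite /normal_prob integral_mkcond [RHS]integral_mkcond.
rewrite (@ge0_integral_affine _ s 0)//; last 2 first.
- apply/(measurable_restrictT _ mA)/measurable_EFinP/measurable_funTS.
  exact: measurable_normal_pdf.
- by move=> x; apply: erestrict_ge0 => y _; rewrite lee_fin normal_pdf_ge0.
rewrite -ge0_integralZl//; last 3 first.
- apply: (@measurableT_comp _ _ _ _ _ _ ((EFin \o normal_pdf 0 s) \_ A)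
    _ (fun x : R => s * x + 0)).
    apply/(measurable_restrictT _ mA)/measurable_EFinP/measurable_funTS.
    exact: measurable_normal_pdf.
  by apply: measurable_funD => //; exact: measurable_funM.
- by move=> x _; apply: erestrict_ge0 => y _; rewrite lee_fin normal_pdf_ge0.
- by rewrite lee_fin ltW.
apply: eq_integral => x _; rewrite !patchE addr0.
have -> : (x \in (fun x : R => s * x) @^-1` A) = (s * x \in A).
  by apply/idP/idP => /set_mem xA; exact/mem_set.
rewrite -(normal_pdf_scale x s0).
by case: ifPn => xA; rewrite ?mule0// EFinM.
Qed.

Lemma std_normal_point (a : R) : normal_prob 0 1 [set a] = 0%E.
Proof.
have /null_content_dominatesP dom := @normal_prob_dominates R 0 1.
by apply: dom => //; exact: lebesgue_measure_set1.
Qed.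

(** The mass outside a neighbourhood of 0 cannot vanish for all
   neighbourhoods, as it would then concentrate on a point. *)
Lemma std_normal_away0 :
  exists2 e : R, 0 < e & (0 < normal_prob (0 : R) 1 (outside e))%E.
Proof.
apply: contrapT => noe.
have mF n : measurable (outside n.+1%:R^-1) by exact: measurable_outside.
have F0 n : normal_prob (0 : R) 1 (outside n.+1%:R^-1) = 0%E.
  apply/eqP; apply: contrapT => F_neq0; apply: noe; exists n.+1%:R^-1 => //.
  by rewrite lt0e measure_ge0 andbT; apply/negP.
have mU : measurable (\bigcup_n (outside n.+1%:R^-1)).
  by apply: bigcup_measurable => n _; exact: mF.
have U0 : normal_prob (0 : R) 1 (\bigcup_n (outside n.+1%:R^-1)) = 0%E.
  apply: measure_negligible => //.
  apply: negligible_bigcup => n; apply/negligibleP; [exact: mF|exact: F0].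
have : normal_prob (0 : R) 1 setT = 0%E.
  have -> : [set: R] = \bigcup_n (outside n.+1%:R^-1) `|` [set 0].
    apply/esym; rewrite -subTset => x _; have [->|x0] := eqVneq x 0; first by right.
    left; have [N hN] := @inv_nat_lt R `|x| ltac:(by rewrite normr_gt0).
    by exists N => //=; exact: hN.
  apply: measure_negligible.
    by apply: measurableU.
  apply: negligibleU.
    by apply/negligibleP.
  by apply/negligibleP => //; exact: std_normal_point.
by rewrite probability_setT => /eqP; rewrite onee_eq0.
Qed.

(** Positivity lets the scale of a Gaussian variable be read off its second moment.
   For finiteness the density is compared with one of larger variance. *)
Lemma std_normal_second_moment : exists2 v : R, 0 < v &
  (\int[normal_prob 0 1]_x (x ^+ 2)%:E = v%:E)%E.
Proof.
have m2 : measurable_fun [set: R] (fun x : R => (x ^+ 2)%:E).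
  by apply/measurable_EFinP; exact: measurable_funX.
have fin : (\int[normal_prob (0 : R) 1]_x (x ^+ 2)%:E < +oo)%E.
  rewrite ge0_integral_normal_prob//; last by move=> x; rewrite lee_fin sqr_ge0.
  (* [y <= expR y] at [y = x^2 / 4] leaves a normal density of variance 2. *)
  pose r : R := Num.sqrt 2.
  have r0 : r != 0 by rewrite gt_eqF// sqrtr_gt0.
  pose C := 4 * (normal_peak 1 / normal_peak r) : R.
  apply: (@le_lt_trans _ _ (\int[lam]_x (C%:E * (normal_pdf 0 r x)%:E))%E).
    apply: ge0_le_integral => //.
    - by move=> x _; rewrite mule_ge0// lee_fin ?sqr_ge0// normal_pdf_ge0.
    - apply: emeasurable_funM => //; apply/measurable_EFinP.
      exact: measurable_normal_pdf.
    - apply: emeasurable_funM => //; apply/measurable_EFinP.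
      exact: measurable_normal_pdf.
    - move=> x _; rewrite -!EFinM lee_fin !normal_pdfE ?oner_eq0// /normal_fun.
      rewrite subr0 sqr_sqrtr// expr1n.
      have -> : C * (normal_peak r * expR (- x ^+ 2 / (2 *+ 2))) =
          normal_peak 1 * (4 * expR (- x ^+ 2 / (2 *+ 2))).
        by rewrite /C; field; rewrite gt_eqF// normal_peak_gt0.
      rewrite mulrCA ler_wpM2l ?normal_peak_ge0//.
      have -> : - x ^+ 2 / (1 *+ 2) = - (x ^+ 2 / 4) + - x ^+ 2 / (2 *+ 2).
        by field.
      rewrite expRD mulrA ler_wpM2r ?expR_ge0//.
      rewrite expRN ler_pdivrMr ?expR_gt0//.
      by have := expR_ge1Dx (x ^+ 2 / 4); lra.
  rewrite ge0_integralZl//.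
  - by rewrite integral_normal_pdf mule1 ltry.
  - apply/measurable_EFinP; exact: measurable_normal_pdf.
  - by move=> x _; rewrite lee_fin normal_pdf_ge0.
  - by rewrite lee_fin mulr_ge0// divr_ge0// normal_peak_ge0.
have ge0 : (0 <= \int[normal_prob (0 : R) 1]_x (x ^+ 2)%:E)%E.
  by apply: integral_ge0 => x _; rewrite lee_fin sqr_ge0.
exists (fine (\int[normal_prob (0 : R) 1]_x (x ^+ 2)%:E)%E); last first.
  by rewrite fineK// ge0_fin_numE.
rewrite fine_gt0// fin andbT.
have [e e0 he] := std_normal_away0.
have mE := measurable_outside e.
apply: (@lt_le_trans _ _ (\int[normal_prob (0 : R) 1]_x
  ((e ^+ 2)%:E * (\1_(outside e) x)%:E))%E).
  rewrite ge0_integralZl//; last by rewrite lee_fin sqr_ge0.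
    by rewrite integral_indic// setIT mule_gt0// lte_fin exprn_gt0.
  by apply/measurable_EFinP; exact: measurable_indic.
apply: ge0_le_integral => //.
- by move=> x _; rewrite mule_ge0// lee_fin// sqr_ge0.
- apply: emeasurable_funM => //.
  by apply/measurable_EFinP; exact: measurable_indic.
- move=> x _; rewrite -EFinM lee_fin indicE.
  case: (boolP (x \in outside e)) => [/set_mem xe|_]; last by rewrite mulr0 sqr_ge0.
  rewrite mulr1 -(real_normK (num_real x)) ler_sqr ?nnegrE//; exact: ltW.
Qed.

End ScaledNormal.

(** * Multiples of a standard normal variable *)

Section ScaledLaw.
Context {R : realType} {d : measure_display} {Omega : measurableType d}.
Variable P : probability Omega R.
Implicit Types (X Y W : {RV P >-> R}) (s t : R).

(** The law of [s] times a standard normal variable; unlike [normal_prob 0 s],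
   this family is continuous at [s = 0], where it gives the Dirac mass. *)
Definition scaled_normal Y s := forall A : set R, measurable A ->
  P (Y @^-1` A) = normal_prob 0 1 ((fun x : R => s * x) @^-1` A).

Lemma zero_mean_gaussianP Y :
  zero_mean_gaussian Y <-> exists2 s, 0 <= s & scaled_normal Y s.
Proof.
have degenerate (A : set R) :
    normal_prob 0 1 ((fun x : R => 0 * x) @^-1` A) = \d_(0 : R) A.
  rewrite diracE; case: (boolP (0 \in A)) => [/set_mem A0|/negP A0].
    rewrite (_ : _ @^-1` _ = setT) ?probability_setT//.
    by apply/seteqP; split=> // x _ /=; rewrite mul0r.
  rewrite (_ : _ @^-1` _ = set0) ?measure0//.
  by rewrite -subset0 => x /=; rewrite mul0r => /mem_set.
split=> [[h|[s s0 h]]|[s]].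
- by exists 0 => // A mA; rewrite degenerate -h.
- exists s => [|A mA]; first exact: ltW.
  by rewrite -normal_prob_scale// -h.
- rewrite le_eqVlt => /predU1P[<-|s0] h.
    by left=> A mA; rewrite -degenerate -h.
  by right; exists s => // A mA; rewrite normal_prob_scale// -h.
Qed.

Lemma ge0_integral_scaled_normal Y s (f : R -> \bar R) : scaled_normal Y s ->
    measurable_fun setT f -> (forall x, (0 <= f x)%E) ->
  (\int[P]_w f (Y w) = \int[normal_prob 0 1]_x f (s * x)%R)%E.
Proof.
move=> Ys mf f0.
have mY : measurable_fun setT (Y : Omega -> measurableTypeR R).
  by move=> _ A mA; exact: (@measurable_funPT _ _ Omega R Y measurableT A mA).
pose mu : {measure set (measurableTypeR R) -> \bar R} := image_measure P mY.
pose nu : {measure set (measurableTypeR R) -> \bar R} :=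
  image_measure (normal_prob 0 1) (measurable_scale s).
transitivity (\int[mu]_x f x)%E; first by rewrite ge0_integral_pushforward.
transitivity (\int[nu]_x f x)%E; last first.
  by rewrite ge0_integral_pushforward//; exact: measurable_scale.
have E := @eq_measure_integral _ (measurableTypeR R) R setT nu mu f.
by apply: E => A mA _; exact: Ys.
Qed.

End ScaledLaw.

(** * Limits of Gaussian variables *)

Section RayUniqueness.
Context {R : realType}.

Lemma measure_eq_rays (m1 m2 : {measure set (measurableTypeR R) -> \bar R}) :
    (m1 setT < +oo)%E ->
    (forall a : R, m1 `]a, +oo[%classic = m2 `]a, +oo[%classic) ->
  forall A : set R, measurable A -> m1 A = m2 A.
Proof.
move=> m1fin eq12 A mA.
apply: (@measure_unique _ _ (measurableTypeR R) (@RGenOInfty.G R)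
   (fun n => `](- n%:R)%R, +oo[%classic)) => //.
- exact: RGenOInfty.measurableE.
- move=> _ _ [a ->] [b ->]; exists (Num.max a b).
  apply/seteqP; split => x /=; rewrite !in_itv/= !andbT gt_max.
    by case=> -> ->.
  by move=> /andP[].
- by move=> n; exists (- n%:R).
- rewrite -subTset => x _; exists (Num.bound `|x|) => //=.
  rewrite in_itv/= andbT ltrNl (le_lt_trans (ler_norm _))// normrN.
  exact: archi_boundP.
- by move=> _ [a ->]; exact: eq12.
- by move=> n; apply: le_lt_trans m1fin; rewrite le_measure ?inE.
Qed.

(** Bounded continuous functions that increase to the indicator of a ray. *)
Definition ray_approx (a : R) (k : nat) (x : R) : R :=
  1 - (1 + k%:R * (`|x - a| + (x - a)))^-1.

Lemma ray_approx_den_ge1 a k x : 1 <= 1 + k%:R * (`|x - a| + (x - a)) :> R.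
Proof.
rewrite lerDl mulr_ge0//; have := ler_norm (- (x - a)); rewrite normrN; lra.
Qed.

Lemma ray_approx_itv a k x : 0 <= ray_approx a k x <= 1.
Proof.
rewrite /ray_approx subr_ge0 lerBlDr lerDl.
have h := ray_approx_den_ge1 a k x; have h0 := lt_le_trans ltr01 h.
by rewrite invr_ge0 (ltW h0) invf_le1// h.
Qed.

Lemma continuous_ray_approx a k : continuous (ray_approx a k).
Proof.
move=> x; rewrite /ray_approx; apply: cvgB; first exact: cvg_cst.
apply: cvgV.
  by rewrite gt_eqF// (lt_le_trans ltr01)// ray_approx_den_ge1.
apply: cvgD; first exact: cvg_cst.
apply: cvgM; first exact: cvg_cst.
have c : (y - a) @[y --> x] --> x - a by apply: cvgB; [exact: cvg_id|exact: cvg_cst].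
by apply: cvgD => //; exact: cvg_norm.
Qed.

Lemma measurable_ray_approx a k : measurable_fun setT (ray_approx a k).
Proof. by apply: continuous_measurable_fun; exact: continuous_ray_approx. Qed.

Lemma ray_approx_cvg a x :
  ray_approx a k x @[k --> \oo] --> (\1_`]a, +oo[%classic x : R).
Proof.
rewrite indicE; case: (boolP (x \in _)) => [/set_mem|/negP xa].
  rewrite /= in_itv/= andbT => ax.
  have m0 : 0 < `|x - a| + (x - a).
    by rewrite gtr0_norm ?subr_gt0// addr_gt0// subr_gt0.
  have den_ge1 k := ray_approx_den_ge1 a k x; rewrite /ray_approx.
  move: (`|x - a| + (x - a)) m0 den_ge1 => m m0 den_ge1.
  rewrite -[X in _ --> X](subr0 (1 : R)); apply: cvgB; first exact: cvg_cst.
  apply/cvg_seqP => e e0.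
  have [N hN] := @inv_nat_lt R (e * m) ltac:(by rewrite mulr_gt0).
  exists N.+1 => -[//|n] Nn; have /hN := (Nn : (N <= n)%N).
  have h0 : 0 < 1 + n.+1%:R * m by exact: lt_le_trans ltr01 (den_ge1 _).
  have n0 : 0 < n.+1%:R :> R by [].
  rewrite subr0 ger0_norm ?invr_ge0 ?(ltW h0)// -(ler_pM2r h0) mulVf ?gt_eqF//.
  rewrite -(ltr_pM2l n0) mulfV ?gt_eqF// => h1.
  rewrite mulrDr mulr1 mulrCA; move: h1; lra.
have -> : (fun k => ray_approx a k x) = cst 0.
  apply/funext => k; rewrite /ray_approx ler0_norm ?addNr ?mulr0 ?addr0 ?invr1 ?subrr//.
  rewrite leNgt; apply/negP => h; apply: xa; apply/mem_set => /=.
  by rewrite in_itv/= andbT -subr_gt0.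
exact: cvg_cst.
Qed.

End RayUniqueness.

Lemma bounded_convergence {R : realType} d (T : measurableType d)
    (m : probability T R) (f_ : nat -> T -> R) (f : T -> R) :
    (forall n, measurable_fun setT (f_ n)) -> measurable_fun setT f ->
    (forall n x, 0 <= f_ n x <= 1) ->
    {ae m, forall x, f_ n x @[n --> \oo] --> f x} ->
  (\int[m]_x (f_ n x)%:E @[n --> \oo] --> \int[m]_x (f x)%:E)%E.
Proof.
move=> mf_ mf f01 ae.
have [|||||_ _ cf] := @dominated_convergence _ T R m setT measurableT
    (fun n x => (f_ n x)%:E) (EFin \o f) (EFin \o cst 1).
- by move=> n; apply/measurable_EFinP.
- by apply/measurable_EFinP.
- apply: filterS ae => x fx _.
  by apply: cvg_EFin; [exact: nearW|exact: fx].
- exact: finite_measure_integrable_cst.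
- apply: aeW => x n _; rewrite lee_fin.
  by have /andP[f0 f1] := f01 n x; rewrite ger0_norm.
- exact: cf.
Qed.

Section GaussianLimits.
Context {R : realType} {d : measure_display} {Omega : measurableType d}.
Variable P : probability Omega R.
Implicit Types (X Y W : {RV P >-> R}) (s t : R).

Lemma measurable_RV Y : measurable_fun setT (Y : Omega -> measurableTypeR R).
Proof.
by move=> _ A mA; exact: (@measurable_funPT _ _ Omega R Y measurableT A mA).
Qed.

(** Rays generate the Borel sets, so they determine a law. *)
Lemma scaled_normal_eq_law Y s :
    (forall a : R, P (Y @^-1` `]a, +oo[%classic) =
       normal_prob 0 1 ((fun x : R => s * x) @^-1` `]a, +oo[%classic)) ->
  scaled_normal Y s.
Proof.
move=> h A mA.
pose mu : {measure set (measurableTypeR R) -> \bar R} :=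
  image_measure P (measurable_RV Y).
pose nu : {measure set (measurableTypeR R) -> \bar R} :=
  image_measure (normal_prob 0 1) (measurable_scale s).
apply: (@measure_eq_rays R mu nu) => //.
by rewrite -[mu setT]/(P setT) probability_setT ltry.
Qed.

(** For a bounded continuous [phi], dominated convergence applies on both sides of
   [E (phi (Y_n)) = E (phi (s_n N))], with [N] standard normal; letting [phi]
   increase to the indicator of a ray then identifies the law of the limit. *)
Lemma scaled_normal_limit (Y_ : nat -> {RV P >-> R}) Y (s_ : nat -> R) s :
    (forall n, scaled_normal (Y_ n) (s_ n)) -> s_ @ \oo --> s ->
    {ae P, forall w, Y_ n w @[n --> \oo] --> Y w} ->
  scaled_normal Y s.
Proof.
move=> lawY s_s Y_Y; apply: scaled_normal_eq_law => a.
have phi01 k x := ray_approx_itv a k x.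
have mphi k := measurable_ray_approx a k.
have mphiE k : measurable_fun setT (fun x : R => (ray_approx a k x)%:E).
  exact/measurable_EFinP.
have phi0 k (x : R) : (0 <= (ray_approx a k x)%:E)%E.
  by rewrite lee_fin; case/andP: (phi01 k x).
have eq_k k : (\int[P]_w (ray_approx a k (Y w))%:E =
    \int[normal_prob 0 1]_x (ray_approx a k (s * x))%:E)%E.
  have c1 : (\int[P]_w (ray_approx a k (Y_ n w))%:E @[n --> \oo] -->
      \int[P]_w (ray_approx a k (Y w))%:E)%E.
    apply: bounded_convergence => //.
    - by move=> n; exact: measurableT_comp.
    - exact: measurableT_comp.
    - apply: filterS Y_Y => w cw.
      exact: (cvg_comp _ _ cw (@continuous_ray_approx _ a k (Y w))).
  have c2 : (\int[normal_prob 0 1]_x (ray_approx a k (s_ n * x))%:E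
      @[n --> \oo] --> \int[normal_prob 0 1]_x (ray_approx a k (s * x))%:E)%E.
    apply: bounded_convergence => //.
    - move=> n; apply: (measurableT_comp (mphi k)).
      exact: (measurable_scale (s_ n)).
    - by apply: (measurableT_comp (mphi k)); exact: (measurable_scale s).
    - apply: aeW => x.
      have cx : s_ n * x @[n --> \oo] --> s * x.
        by apply: cvgM => //; exact: cvg_cst.
      exact: (cvg_comp _ _ cx (@continuous_ray_approx _ a k (s * x))).
  apply: (cvg_unique _ c1) => //.
  apply: cvg_trans c2; apply: near_eq_cvg; near=> n.
  exact/esym/(ge0_integral_scaled_normal (lawY n) (mphiE k) (phi0 k)).
have mI : measurable (`]a, +oo[%classic : set (measurableTypeR R)) by [].
have c1 : (\int[P]_w (ray_approx a k (Y w))%:E @[k --> \oo] -->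
    \int[P]_w (\1_`]a, +oo[%classic (Y w))%:E)%E.
  apply: bounded_convergence => //.
  - by move=> k; exact: measurableT_comp.
  - by apply: measurableT_comp => //; exact: measurable_indic.
  - by apply: aeW => w; exact: ray_approx_cvg.
have c2 : (\int[normal_prob 0 1]_x (ray_approx a k (s * x))%:E
    @[k --> \oo] --> \int[normal_prob 0 1]_x (\1_`]a, +oo[%classic (s * x))%:E)%E.
  apply: bounded_convergence => //.
  - by move=> k; apply: (measurableT_comp (mphi k)); exact: (measurable_scale s).
  - apply: (@measurableT_comp _ _ _ _ _ _ (\1_`]a, +oo[%classic : R -> R)).
      exact: measurable_indic.
    exact: (measurable_scale s).
  - by apply: aeW => x; exact: ray_approx_cvg.
have eqI : (\int[P]_w (\1_`]a, +oo[%classic (Y w))%:E =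
    \int[normal_prob 0 1]_x (\1_`]a, +oo[%classic (s * x))%:E)%E.
  apply: (cvg_unique _ c1) => //.
  apply: cvg_trans c2; apply: near_eq_cvg; near=> k; exact/esym/eq_k.
transitivity (\int[P]_w (\1_`]a, +oo[%classic (Y w))%:E)%E.
  rewrite -[X in P X]setIT -integral_indic//.
  have := @measurable_RV Y measurableT _ mI; rewrite setTI; exact.
rewrite eqI -[X in _ = normal_prob 0 1 X]setIT -integral_indic//.
exact: measurable_scale_preimage.
Unshelve. all: by end_near. Qed.

End GaussianLimits.

(** * Convolution of normal laws *)

Section Convolution.
Context {R : realType}.
Local Notation lam := (@lebesgue_measure R).

Lemma normal_peakE (s : R) : 0 < s ->
  normal_peak s = (s * Num.sqrt (pi *+ 2))^-1.
Proof.
move=> s0; rewrite /normal_peak -mulrnAr sqrtrM ?sqr_ge0// sqrtr_sqr.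
by rewrite gtr0_norm.
Qed.

(** Completing the square in [x]: the joint density of [(x, z - x)] factors into
   the density of the sum and a conditional density of the first summand. *)
Lemma normal_pdf_complete_square (s t x z : R) : 0 < s -> 0 < t ->
  let r := Num.sqrt (s ^+ 2 + t ^+ 2) in
  normal_pdf 0 s x * normal_pdf x t z =
  normal_pdf 0 r z * normal_pdf (s ^+ 2 * z / r ^+ 2) (s * t / r) x.
Proof.
move=> s0 t0 r.
have st0 : 0 < s ^+ 2 + t ^+ 2 by rewrite addr_gt0 ?exprn_gt0.
have r0 : 0 < r by rewrite sqrtr_gt0.
have rE : r ^+ 2 = s ^+ 2 + t ^+ 2 by rewrite sqr_sqrtr// ltW.
have q0 : 0 < Num.sqrt (pi *+ 2 : R) by rewrite sqrtr_gt0 pmulrn_lgt0// pi_gt0.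
have u0 : 0 < s * t / r by rewrite divr_gt0// mulr_gt0.
rewrite !normal_pdfE ?gt_eqF// /normal_fun !normal_peakE//.
rewrite mulrACA [RHS]mulrACA -!expRD; congr (_ * expR _).
  by field; rewrite !gt_eqF.
rewrite !exprMn exprVn rE.
by field; rewrite !gt_eqF.
Qed.

Lemma normal_prob_shift (x t : R) (A : set R) : 0 < t -> measurable A ->
  normal_prob 0 t ((fun y : R => x + y) @^-1` A) = normal_prob x t A.
Proof.
move=> t0 mA; rewrite /normal_prob integral_mkcond [RHS]integral_mkcond.
rewrite [RHS](@ge0_integral_affine _ 1 x)//; last 2 first.
- apply/(measurable_restrictT _ mA)/measurable_EFinP/measurable_funTS.
  exact: measurable_normal_pdf.
- by move=> y; apply: erestrict_ge0 => z _; rewrite lee_fin normal_pdf_ge0.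
rewrite mul1e; apply: eq_integral => y _; rewrite !patchE mul1r addrC.
have -> : (y \in (fun y : R => x + y) @^-1` A) = (x + y \in A).
  by apply/idP/idP => /set_mem yA; exact/mem_set.
case: ifPn => // _; congr EFin; rewrite !normal_pdfE ?gt_eqF// /normal_fun.
by rewrite subr0 [x + y - x]addrAC subrr add0r.
Qed.

Lemma normal_prob_mkcond (x t : R) (A : set R) : 0 < t -> measurable A ->
  (normal_prob x t A =
   \int[lam]_z (\1_A z * normal_pdf 0 t (z - x))%:E)%E.
Proof.
move=> t0 mA; rewrite /normal_prob integral_mkcond.
apply: eq_integral => z _; rewrite patchE indicE.
case: ifPn => _; last by rewrite mul0r.
by rewrite mul1r !normal_pdfE ?gt_eqF// /normal_fun subr0.
Qed.

(** By Tonelli and the factorization of the joint density, the inner integral is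
   that of a normal density, hence 1. *)
Lemma normal_prob_convolution (s t : R) (A : set R) : 0 < s -> 0 < t ->
    measurable A ->
  (\int[normal_prob 0 s]_x normal_prob 0 t ((fun y : R => (x + y)%R) @^-1` A) =
   normal_prob 0 (Num.sqrt (s ^+ 2 + t ^+ 2)) A)%E.
Proof.
move=> s0 t0 mA; set r := Num.sqrt _.
pose LR : {sigma_finite_measure set (measurableTypeR R) -> \bar R} := lam.
pose g (u : measurableTypeR R * measurableTypeR R) : \bar R :=
  (\1_A u.2 * normal_pdf 0 t (u.2 - u.1))%:E.
have g0 u : (0 <= g u)%E by rewrite lee_fin mulr_ge0// normal_pdf_ge0.
have mg : measurable_fun setT g.
  apply/measurable_EFinP; apply: measurable_funM.
    by apply: measurableT_comp => //; exact: measurable_indic.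
  apply: (measurableT_comp (measurable_normal_pdf 0 t)).
  by apply: measurable_funB.
pose p (x : R) : \bar R := (normal_pdf 0 s x)%:E.
have p0 x : (0 <= p x)%E by rewrite lee_fin normal_pdf_ge0.
have mp : measurable_fun [set: measurableTypeR R] p.
  by apply/measurable_EFinP; exact: measurable_normal_pdf.
transitivity (\int[normal_prob 0 s]_x \int[lam]_z g (x, z))%E.
  by apply: eq_integral => x _; rewrite normal_prob_shift// normal_prob_mkcond.
rewrite ge0_integral_normal_prob//; last 2 first.
- exact: (@measurable_fun_fubini_tonelli_F _ _ _ _ R LR g).
- by move=> x; exact: integral_ge0.
transitivity (\int[LR]_x \int[LR]_z (g (x, z) * p x))%E.
  apply: eq_integral => x _; rewrite ge0_integralZr//.
  exact: (measurableT_comp mg).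
rewrite (@fubini_tonelli _ _ _ _ R LR LR (fun u => g u * p u.1)%E); last 2 first.
- apply: emeasurable_funM => //; exact: (measurableT_comp mp).
- by move=> u; rewrite mule_ge0.
rewrite /normal_prob [RHS]integral_mkcond; apply: eq_integral => z _.
rewrite patchE /=.
transitivity (\int[lam]_x ((\1_A z * normal_pdf 0 r z)%:E *
    (normal_pdf (s ^+ 2 * z / r ^+ 2) (s * t / r) x)%:E))%E.
  apply: eq_integral => x _; rewrite /g /p -!EFinM; congr EFin.
  have E := normal_pdf_complete_square x z s0 t0.
  rewrite /= -/r in E; rewrite /= -!(mulrA (\1_A z)) -E; congr (_ * _).
  rewrite mulrC; congr (_ * _).
  by rewrite !normal_pdfE ?gt_eqF// /normal_fun subr0.
rewrite ge0_integralZl//.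
- rewrite integral_normal_pdf mule1 indicE.
  by case: (boolP (z \in A)) => _; rewrite ?mul1r ?mul0r.
- by apply/measurable_EFinP; exact: measurable_normal_pdf.
- by move=> x _; rewrite lee_fin normal_pdf_ge0.
- by rewrite lee_fin mulr_ge0// normal_pdf_ge0.
Qed.

End Convolution.

(** * Square-integrable random variables *)

Section SquareIntegrable.
Context {R : realType} {d : measure_display} {Omega : measurableType d}.
Variable P : probability Omega R.
Implicit Types X Y Z : Omega -> R.

Definition square_integrable X :=
  measurable_fun setT X /\ P.-integrable setT (fun w => (X w ^+ 2)%:E).

(** The inner product of the space of square-integrable variables. *)
Definition moment X Y : R := \int[P]_w (X w * Y w).

Lemma square_integrable_mul X Y : square_integrable X -> square_integrable Y ->
  P.-integrable setT (EFin \o (fun w => X w * Y w)).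
Proof.
move=> [mX iX] [mY iY].
apply: (@le_integrable _ _ _ P setT measurableT _
  (fun w => (X w ^+ 2)%:E + (Y w ^+ 2)%:E)%E).
- by apply/measurable_EFinP; exact: measurable_funM.
- move=> w _ /=; rewrite lee_fin [leRHS]ger0_norm ?addr_ge0 ?sqr_ge0//.
  by rewrite ler_norml; apply/andP; split; nra.
- exact: integrableD.
Qed.

Lemma square_integrable_lin (a b : R) X Y :
    square_integrable X -> square_integrable Y ->
  square_integrable (fun w => a * X w + b * Y w).
Proof.
move=> sX sY; have [mX iX] := sX; have [mY iY] := sY; split.
  by apply: measurable_funD; exact: measurable_funM.
have -> : (fun w => ((a * X w + b * Y w) ^+ 2)%:E) =
    (fun w => ((a ^+ 2)%:E * (X w ^+ 2)%:E + (2 * a * b)%:E * (X w * Y w)%:E) +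
      (b ^+ 2)%:E * (Y w ^+ 2)%:E)%E.
  by apply/funext => w /=; rewrite -!EFinM -!EFinD; congr EFin; ring.
apply: integrableD => //; last exact: integrableZl.
apply: integrableD => //; first exact: integrableZl.
by apply: integrableZl => //; exact: square_integrable_mul.
Qed.

Lemma momentC X Y : moment X Y = moment Y X.
Proof. by apply: eq_Rintegral => w _; rewrite mulrC. Qed.

Lemma moment_linl (a b : R) X Y Z : square_integrable X ->
    square_integrable Y -> square_integrable Z ->
  moment (fun w => a * X w + b * Y w) Z = a * moment X Z + b * moment Y Z.
Proof.
move=> sX sY sZ; rewrite /moment.
have iX := square_integrable_mul sX sZ; have iY := square_integrable_mul sY sZ.
rewrite -!RintegralZl// -RintegralD//.
- by apply: eq_Rintegral => w _; ring.
- exact: (integrableZl measurableT a iX).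
- exact: (integrableZl measurableT b iY).
Qed.

Lemma moment_linr (a b : R) X Y Z : square_integrable X ->
    square_integrable Y -> square_integrable Z ->
  moment Z (fun w => a * X w + b * Y w) = a * moment Z X + b * moment Z Y.
Proof.
by move=> sX sY sZ; rewrite momentC moment_linl// (momentC X) (momentC Y).
Qed.

Lemma moment_sqr (a b : R) X Y : square_integrable X -> square_integrable Y ->
  moment (fun w => a * X w + b * Y w) (fun w => a * X w + b * Y w) =
  a ^+ 2 * moment X X + 2 * a * b * moment X Y + b ^+ 2 * moment Y Y.
Proof.
move=> sX sY; have sXY := square_integrable_lin a b sX sY.
by rewrite moment_linl// !moment_linr// (momentC Y X); ring.
Qed.

Lemma moment_ge0 X : 0 <= moment X X.
Proof. by apply: Rintegral_ge0 => w _; rewrite -expr2 sqr_ge0. Qed.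

Lemma integral_sqr X : square_integrable X ->
  (\int[P]_w (X w ^+ 2)%:E = (moment X X)%:E)%E.
Proof.
move=> sX; rewrite /moment /Rintegral fineK; last first.
  exact: integrable_fin_num (square_integrable_mul sX sX).
by apply: eq_integral => w _; rewrite expr2.
Qed.

Lemma integral_mul X Y : square_integrable X -> square_integrable Y ->
  (\int[P]_w (X w * Y w)%:E = (moment X Y)%:E)%E.
Proof.
move=> sX sY; rewrite /moment /Rintegral fineK//.
exact: integrable_fin_num (square_integrable_mul sX sY).
Qed.

Lemma moment_le X Y : square_integrable X -> square_integrable Y ->
  moment X Y ^+ 2 <= moment X X * moment Y Y.
Proof.
move=> sX sY; apply: quadratic_ge0_discr => [|t]; first exact: moment_ge0.
have := moment_ge0 (fun w => 1 * X w + t * Y w).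
by rewrite moment_sqr// expr1n mul1r mulr1.
Qed.

Lemma moment_eq0 X : square_integrable X -> moment X X = 0 ->
  {ae P, forall w, X w = 0}.
Proof.
move=> sX X0; have [mX _] := sX.
have m2 : measurable_fun setT (fun w => (X w ^+ 2)%:E).
  by apply/measurable_EFinP; exact: measurable_funX.
have /ae_eq_integral_abs : (\int[P]_w `|(X w ^+ 2)%:E| = 0)%E.
  under eq_integral do rewrite gee0_abs ?lee_fin ?sqr_ge0//.
  by rewrite integral_sqr// X0.
move=> /(_ measurableT m2); apply: filterS => w /(_ I) /= [] /eqP.
by rewrite sqrf_eq0 => /eqP.
Qed.

Lemma moment_ae_eq X X' Y : measurable_fun setT X -> measurable_fun setT X' ->
    measurable_fun setT Y ->
    {ae P, forall w, X w = X' w} -> moment X Y = moment X' Y.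
Proof.
move=> mX mX' mY XX'; congr fine; apply: ae_eq_integral => //.
- by apply/measurable_EFinP; exact: measurable_funM.
- by apply/measurable_EFinP; exact: measurable_funM.
- by apply: filterS XX' => w -> _.
Qed.

End SquareIntegrable.

(** * Almost sure limits of fast Cauchy sequences *)

Section FastLimit.
Context {R : realType} {d : measure_display} {Omega : measurableType d}.
Variable P : probability Omega R.

(** Integrate the arithmetic-geometric inequality [2 c |X| <= c^2 + X^2]. *)
Lemma integral_norm_le (X : Omega -> R) (c : R) : 0 < c ->
    measurable_fun setT X ->
    (\int[P]_w (X w ^+ 2)%:E <= (c ^+ 2)%:E)%E ->
  (\int[P]_w `|X w|%:E <= c%:E)%E.
Proof.
move=> c0 mX h.
have m2 : measurable_fun setT (fun w => (X w ^+ 2)%:E).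
  by apply/measurable_EFinP; exact: measurable_funX.
apply: (@le_trans _ _ (\int[P]_w ((c / 2)%:E + (2 * c)^-1%:E * (X w ^+ 2)%:E))%E).
  apply: ge0_le_integral => //.
  - by apply/measurable_EFinP; exact: measurableT_comp.
  - by apply: emeasurable_funD => //; exact: emeasurable_funM.
  - move=> w _; rewrite -EFinM -EFinD lee_fin.
    rewrite -(@ler_pM2l _ (2 * c)) ?mulr_gt0// mulrDr mulVKf ?gt_eqF ?mulr_gt0//.
    have -> : 2 * c * (c / 2) = c ^+ 2 by field.
    have := sqr_ge0 (c - `|X w|).
    by have := real_normK (num_real (X w)); lra.
rewrite ge0_integralD//; first last.
- exact: emeasurable_funM.
- by move=> w _; rewrite mule_ge0// lee_fin ?sqr_ge0// invr_ge0 mulr_ge0// ltW.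
- by move=> w _; rewrite lee_fin divr_ge0// ltW.
have -> : (\int[P]_(w in setT) (c / 2)%:E = (c / 2)%:E)%E.
  rewrite integral_cst// -[RHS]mule1; congr (_ * _)%E; exact: probability_setT.
rewrite ge0_integralZl//; last 2 first.
- by move=> w _; rewrite lee_fin sqr_ge0.
- by rewrite lee_fin invr_ge0 mulr_ge0// ltW.
apply: (@le_trans _ _ ((c / 2)%:E + (2 * c)^-1%:E * (c ^+ 2)%:E)%E).
  by rewrite leeD2l// lee_wpmul2l// lee_fin invr_ge0 mulr_ge0// ltW.
rewrite -EFinM -EFinD lee_fin le_eqVlt; apply/orP; left; apply/eqP; field.
by rewrite gt_eqF.
Qed.

Lemma is_mfunP (f : Omega -> R) : measurable_fun setT f ->
  exists F : {RV P >-> R}, forall w, F w = f w.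
Proof.
move=> mf; pose m := isMeasurableFun.Build _ _ _ _ f mf.
by exists (HB.pack_for {mfun Omega >-> R} f m).
Qed.

Lemma limn_einf_le (u : nat -> \bar R) (c : \bar R) (N : nat) :
  (forall n, (N <= n)%N -> (u n <= c)%E) -> (limn_einf u <= c)%E.
Proof.
move=> uc; rewrite limn_einf_lim; apply: lime_le; first exact: is_cvg_einfs.
apply: nearW => k; apply: (@le_trans _ _ (u (k + N)%N)).
  by apply: ereal_inf_lbound; exists (k + N)%N => //=; rewrite leq_addr.
by apply: uc; rewrite leq_addl.
Qed.

(** The increments have summable means, so their sum is almost surely finite and
   the sequence converges almost surely; Fatou's lemma passes the quadratic bound
   to the limit. *)
Lemma fast_L2_cauchy_limit (Y_ : nat -> {RV P >-> R}) :
    (forall n m, (n <= m)%N ->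
       \int[P]_w ((Y_ m w - Y_ n w) ^+ 2)%:E <= ((2^-1 ^+ n) ^+ 2)%:E)%E ->
  exists Y : {RV P >-> R},
    {ae P, forall w, Y_ n w @[n --> \oo] --> Y w} /\
    forall n, (\int[P]_w ((Y w - Y_ n w) ^+ 2)%:E <= ((2^-1 ^+ n) ^+ 2)%:E)%E.
Proof.
move=> fastY.
have mB n m : measurable_fun setT (fun w => Y_ m w - Y_ n w).
  exact: measurable_funB.
have ae_cvg : {ae P, forall w, exists l : R, Y_ n w @[n --> \oo] --> l}.
  pose g n w : \bar R := `|Y_ n.+1 w - Y_ n w|%:E.
  have g0 n w : (0 <= g n w)%E by rewrite lee_fin.
  have mg n : measurable_fun setT (g n).
    by apply/measurable_EFinP; exact: measurableT_comp.
  have mD : measurable_fun setT (fun w => \sum_(0 <= n <oo) g n w)%E.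
    exact: ge0_emeasurable_sum.
  have D0 w : (0 <= \sum_(0 <= n <oo) g n w)%E by exact: nneseries_ge0.
  have iD : P.-integrable setT (fun w => \sum_(0 <= n <oo) g n w)%E.
    apply/integrableP; split => //.
    under eq_integral do rewrite gee0_abs//.
    rewrite integral_nneseries//.
    apply: (@le_lt_trans _ _ (1 / (1 - 2^-1) : R)%:E); last exact: ltry.
    apply: lime_le.
      by apply: is_cvg_nneseries => n _ _; exact: integral_ge0.
    apply: nearW => n.
    apply: (@le_trans _ _ (series (geometric 1 2^-1) n)%:E); last first.
      rewrite lee_fin; apply: geometric_le_lim => //.
      by rewrite ger0_norm ?invr_ge0// invf_lt1// ltr1n.
    rewrite /series/= -sumEFin; apply: lee_sum => k _; rewrite mul1r.
    have c0 : 0 < 2^-1 ^+ k :> R by rewrite exprn_gt0.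
    exact: (integral_norm_le c0 (mB k k.+1) (fastY _ _ (leqnSn k))).
  have := integrable_ae measurableT iD; apply: filterS => w /(_ I) finD.
  suff : cvgn (series (telescope (fun n => Y_ n w))).
    rewrite telescopeK => c.
    exists (limn [sequence Y_ n w - Y_ 0%N w]_n + Y_ 0%N w).
    rewrite -[X in X @ _](_ : (fun n => Y_ n w - Y_ 0%N w + Y_ 0%N w) = _).
      by apply: cvgD; [exact: c|exact: cvg_cst].
    by apply/funext => n; rewrite subrK.
  apply: normed_cvg; apply: nondecreasing_is_cvgn.
    by apply: nondecreasing_series => n _ _; exact: normr_ge0.
  exists (fine (\sum_(0 <= n <oo) g n w)%E) => _ [n _ <-].
  rewrite -lee_fin fineK//= /series/= -sumEFin.
  exact: (@nneseries_lim_ge R (fun n => g n w) xpredT 0 n).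
(* The upper limit is measurable and is the limit wherever there is one. *)
have mY : measurable_fun setT (fun w => fine (limn_esup (fun n => (Y_ n w)%:E))).
  apply: measurableT_comp => //.
  by apply: measurable_fun_limn_esup => n; exact/measurable_EFinP.
have [Y YE] := is_mfunP mY.
have Y_cvg : {ae P, forall w, Y_ n w @[n --> \oo] --> Y w}.
  apply: filterS ae_cvg => w [l cl].
  have cE : (Y_ n w)%:E @[n --> \oo] --> l%:E.
    by apply: cvg_EFin; [exact: nearW|exact: cl].
  by rewrite YE (cvg_limn_einf_sup cE).2.
exists Y; split => // n.
have m2 (U V : {RV P >-> R}) : measurable_fun setT (fun w => ((U w - V w) ^+ 2)%:E).
  by apply/measurable_EFinP/measurable_funX/measurable_funB.
have -> : (\int[P]_w ((Y w - Y_ n w) ^+ 2)%:E =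
    \int[P]_w limn_einf (fun m => ((Y_ m w - Y_ n w) ^+ 2)%:E))%E.
  apply: ae_eq_integral => //.
    have -> : (fun w => limn_einf (fun m => ((Y_ m w - Y_ n w) ^+ 2)%:E)) =
        (fun w => - limn_esup (fun m => - ((Y_ m w - Y_ n w) ^+ 2)%:E))%E.
      by apply/funext => w; rewrite limn_esupN oppeK.
    apply: measurableT_comp => //; apply: measurable_fun_limn_esup => m.
    exact: measurableT_comp.
  apply: filterS Y_cvg => w cw _.
  have cE : ((Y_ m w - Y_ n w) ^+ 2)%:E @[m --> \oo] --> ((Y w - Y_ n w) ^+ 2)%:E.
    apply: cvg_EFin; first exact: nearW.
    by apply: cvgM; apply: cvgB => //; exact: cvg_cst.
  by rewrite (cvg_limn_einf_sup cE).1.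
apply: le_trans (fatou _ _ _ _) _ => //.
  by move=> m w _; rewrite lee_fin sqr_ge0.
by apply: (@limn_einf_le _ _ n) => m nm; exact: fastY.
Qed.

End FastLimit.

(** * Second moments and independent sums of Gaussian variables *)

Section GaussianMoments.
Context {R : realType} {d : measure_display} {Omega : measurableType d}.
Variable P : probability Omega R.
Implicit Types (X Y W Z : {RV P >-> R}) (s t : R).

Lemma scaled_normal_ae_eq X Y s : {ae P, forall w, X w = Y w} ->
  scaled_normal X s -> scaled_normal Y s.
Proof.
move=> XY Xs; apply: (@scaled_normal_limit _ _ _ P (fun _ => X) Y (fun _ => s)) => //.
- exact: cvg_cst.
- by apply: filterS XY => w <-; exact: cvg_cst.
Qed.

Lemma scaled_normal0 X : scaled_normal X 0 -> {ae P, forall w, X w = 0}.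
Proof.
move=> X0; exists (X @^-1` (~` [set 0])); split.
- rewrite -[X in measurable X]setTI; apply: (@measurable_RV _ _ _ P X) => //.
  exact: measurableC.
- rewrite X0; last exact: measurableC.
  rewrite (_ : _ @^-1` _ = set0) ?measure0//.
  by rewrite -subset0 => x /=; rewrite mul0r.
- by move=> w /= nX0 Xw; apply: nX0.
Qed.

Definition std_var : R := fine (\int[normal_prob (0 : R) 1]_x (x ^+ 2)%:E)%E.

Lemma std_varE : (\int[normal_prob (0 : R) 1]_x (x ^+ 2)%:E = std_var%:E)%E.
Proof. by have [v _ vE] := @std_normal_second_moment R; rewrite /std_var vE. Qed.

Lemma std_var_gt0 : 0 < std_var.
Proof. by have [v v0 vE] := @std_normal_second_moment R; rewrite /std_var vE. Qed.

Lemma scaled_normal_sqr Y s : scaled_normal Y s ->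
  (\int[P]_w (Y w ^+ 2)%:E = (s ^+ 2 * std_var)%:E)%E.
Proof.
move=> Ys.
have m2 : measurable_fun [set: R] (fun x : R => (x ^+ 2)%:E).
  by apply/measurable_EFinP; exact: measurable_funX.
have p2 (x : R) : (0 <= (x ^+ 2)%:E)%E by rewrite lee_fin sqr_ge0.
rewrite (ge0_integral_scaled_normal Ys m2 p2).
under eq_integral do rewrite exprMn EFinM.
by rewrite ge0_integralZl// ?lee_fin ?sqr_ge0// std_varE.
Qed.

Lemma scaled_normal_square_integrable Y s : scaled_normal Y s ->
  square_integrable P Y.
Proof.
move=> Ys; split => //; apply/integrableP; split.
  by apply/measurable_EFinP; exact: measurable_funX.
under eq_integral do rewrite gee0_abs ?lee_fin ?sqr_ge0//.
by rewrite (scaled_normal_sqr Ys) ltry.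
Qed.

Lemma scaled_normal_moment Y s : scaled_normal Y s ->
  moment P Y Y = s ^+ 2 * std_var.
Proof.
move=> Ys; apply/eqP; rewrite -eqe -integral_sqr ?(scaled_normal_sqr Ys)//.
exact: scaled_normal_square_integrable Ys.
Qed.

(** Independence makes the joint law a product, and the law of the sum is then a
   convolution. The degenerate scales 0 are reduced to almost sure equalities. *)
Lemma scaled_normal_add X W Z s t : 0 <= s -> 0 <= t ->
    scaled_normal X s -> scaled_normal W t ->
    (forall A B : set R, measurable A -> measurable B ->
       P ((X @^-1` A) `&` (W @^-1` B)) = (P (X @^-1` A) * P (W @^-1` B))%E) ->
    (forall w, Z w = X w + W w) ->
  scaled_normal Z (Num.sqrt (s ^+ 2 + t ^+ 2)).
Proof.
rewrite le_eqVlt => /predU1P[<- t0 X0 Wt _ ZE|s0].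
  rewrite expr0n add0r sqrtr_sqr ger0_norm//; apply: scaled_normal_ae_eq Wt.
  by apply: filterS (scaled_normal0 X0) => w Xw; rewrite ZE Xw add0r.
rewrite le_eqVlt => /predU1P[<- Xs W0 _ ZE|t0 Xs Wt indep ZE A mA].
  rewrite expr0n addr0 sqrtr_sqr gtr0_norm//; apply: scaled_normal_ae_eq Xs.
  by apply: filterS (scaled_normal0 W0) => w Ww; rewrite ZE Ww addr0.
pose ms := [the {sigma_finite_measure set (measurableTypeR R) -> \bar R} of normal_prob 0 s].
pose mt := [the {sigma_finite_measure set (measurableTypeR R) -> \bar R} of normal_prob 0 t].
have mXW : measurable_fun setT
    (fun w => (X w, W w) : measurableTypeR R * measurableTypeR R).
  by apply/measurable_fun_pairP; split; exact: measurable_RV.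
have prodE E : measurable E -> (ms \x mt)%E E = P ((fun w => (X w, W w)) @^-1` E).
  apply: (@product_measure_unique _ _ _ _ R ms mt (image_measure P mXW)) => B C mB mC.
  transitivity (P ((X @^-1` B) `&` (W @^-1` C))) => //.
  rewrite (indep _ _ mB mC) (Xs _ mB) (Wt _ mC).
  by rewrite -(normal_prob_scale s0 mB) -(normal_prob_scale t0 mC).
rewrite -normal_prob_scale; last 2 first.
- by rewrite sqrtr_gt0 addr_gt0// exprn_gt0.
- by [].
rewrite -normal_prob_convolution//.
pose E : set (measurableTypeR R * measurableTypeR R) := [set u | A (u.1 + u.2)].
have mE : measurable E.
  rewrite -[X in measurable X]setTI.
  have mD : measurable_fun setT
    (fun u : measurableTypeR R * measurableTypeR R => u.1 + u.2 : measurableTypeR R).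
    exact: measurable_funD.
  exact: mD.
have -> : Z @^-1` A = (fun w => (X w, W w)) @^-1` E.
  by apply/seteqP; split => w; rewrite /E/= ZE.
rewrite -(prodE E mE); apply: eq_integral => x _ /=.
congr normal_prob; apply/seteqP; split => y; rewrite /xsection/= inE//.
Qed.

End GaussianMoments.

(** * Covariance and extension of Gaussian fields *)

Section GaussianFields.
Context {R : realType} {d : measure_display} {Omega : measurableType d}.
Variable P : probability Omega R.
Variable H : hilbertSpace R.

Lemma expectation_moment (X Y : {RV P >-> R}) :
    square_integrable P X -> square_integrable P Y ->
  ('E_P[X \* Y] = (moment P X Y)%:E)%E.
Proof. by move=> sX sY; rewrite unlock -integral_mul. Qed.

Lemma chebyshev_moment (Z : Omega -> R) (e : R) : 0 < e ->
    square_integrable P Z ->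
  (P [set w | (e < `|Z w|)%R] <= (moment P Z Z / e ^+ 2)%:E)%E.
Proof.
move=> e0 sZ; have [mZ _] := sZ.
set A := [set w | _].
have mA : measurable A.
  have := (measurableT_comp (@normr_measurable R setT) mZ) measurableT
    `]e, +oo[%classic (measurable_itv _).
  rewrite setTI; congr measurable.
  by apply/seteqP; split => w /=; rewrite in_itv/= andbT.
have e2 : 0 < e ^+ 2 by rewrite exprn_gt0.
rewrite EFinM lee_pdivlMr// muleC -integral_sqr//.
rewrite -[X in P X]setIT -integral_indic// -ge0_integralZl//; last 2 first.
- by apply/measurable_EFinP; exact: measurable_indic.
- by rewrite lee_fin ltW.
apply: ge0_le_integral => //.
- by move=> w _; rewrite mule_ge0// lee_fin ?ltW.
- by apply: emeasurable_funM => //; apply/measurable_EFinP; exact: measurable_indic.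
- by apply/measurable_EFinP; exact: measurable_funX.
- move=> w _; rewrite -EFinM lee_fin indicE.
  case: (boolP (w \in A)) => [/set_mem wA|_]; last by rewrite mulr0 sqr_ge0.
  rewrite mulr1 -(real_normK (num_real (Z w))) ler_sqr ?nnegrE ?(ltW e0)//.
  exact: ltW.
Qed.

Lemma zero_mean_gaussian_square_integrable (Y : {RV P >-> R}) :
  zero_mean_gaussian Y -> square_integrable P Y.
Proof.
by move=> /zero_mean_gaussianP[s _]; exact: scaled_normal_square_integrable.
Qed.

Lemma gaussian_scale (Y : {RV P >-> R}) : zero_mean_gaussian Y ->
  scaled_normal Y (Num.sqrt (moment P Y Y / std_var)).
Proof.
move=> /zero_mean_gaussianP[s s0 Ys]; have v0 := @std_var_gt0 R.
by rewrite (scaled_normal_moment Ys) mulfK ?gt_eqF// sqrtr_sqr ger0_norm.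
Qed.

Section Covariance.
Variable X : H -> {RV P >-> R}.
Hypothesis fieldX : gaussian_field X.

Let sX f : square_integrable P (X f).
Proof. by case: fieldX => gX _ _; exact: zero_mean_gaussian_square_integrable. Qed.

Let linX (a b : R) (f g : H) :
  {ae P, forall w, X (a *: f + b *: g) w = a * X f w + b * X g w}.
Proof. by case: fieldX. Qed.

Lemma field_moment_lin (a b : R) (f g : H) (Z : {RV P >-> R}) :
    square_integrable P Z ->
  moment P (X (a *: f + b *: g)) Z = a * moment P (X f) Z + b * moment P (X g) Z.
Proof.
move=> sZ; rewrite -moment_linl//; apply: moment_ae_eq => //.
by apply: measurable_funD; exact: measurable_funM.
Qed.

Lemma field_momentZ (a : R) (f : H) :
  moment P (X (a *: f)) (X (a *: f)) = a ^+ 2 * moment P (X f) (X f).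
Proof.
have -> : a *: f = a *: f + 0 *: f by rewrite scale0r addr0.
by rewrite field_moment_lin// momentC field_moment_lin//; ring.
Qed.

Lemma field0 : {ae P, forall w, X 0 w = 0}.
Proof.
by have := linX 0 0 0 0; rewrite !scaler0 addr0; apply: filterS => w ->; rewrite !mul0r addr0.
Qed.

(** Rescaling a sequence that violates the bound gives vectors that tend to 0
   while their images keep the standard normal law, which contradicts continuity
   in probability. *)
Lemma gaussian_field_bounded :
  exists2 C : R, 0 <= C & forall f, moment P (X f) (X f) <= C * `|f| ^+ 2.
Proof.
case: (fieldX) => gX _ ctsX.
apply: contrapT => unbounded.
have vio (n : nat) : exists g : H, `|g| <= n.+1%:R^-1 /\ scaled_normal (X g) 1.
  have [f fC] : exists f, (@std_var R * n.+1%:R ^+ 2) * `|f| ^+ 2 < moment P (X f) (X f).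
    apply: contrapT => nof; apply: unbounded.
    exists (@std_var R * n.+1%:R ^+ 2).
      by rewrite mulr_ge0 ?sqr_ge0// ltW// std_var_gt0.
    by move=> f; rewrite leNgt; apply/negP => fC; apply: nof; exists f.
  have m0 : 0 < moment P (X f) (X f).
    apply: le_lt_trans fC; rewrite mulr_ge0 ?sqr_ge0// mulr_ge0 ?sqr_ge0//.
    exact/ltW/std_var_gt0.
  have v0 := @std_var_gt0 R.
  (* The factor that brings [X f] to the standard normal law. *)
  pose a := Num.sqrt (@std_var R / moment P (X f) (X f)).
  have a2 : a ^+ 2 = @std_var R / moment P (X f) (X f).
    by rewrite sqr_sqrtr// divr_ge0// ltW.
  exists (a *: f); split.
    rewrite -ler_sqr ?nnegrE// normrZ exprMn real_normK ?num_real// a2.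
    rewrite mulrAC ler_pdivrMr// exprVn ler_pdivlMl ?exprn_gt0//.
    by apply: ltW; rewrite mulrA (mulrC (_ ^+ 2)).
  have /zero_mean_gaussianP[s s0 Xs] := gX (a *: f).
  have := scaled_normal_moment Xs; rewrite field_momentZ a2 divfK ?gt_eqF//.
  rewrite -[LHS]mul1r => /(mulIf (lt0r_neq0 v0)) s1.
  suff -> : 1 = s by [].
  by apply/eqP; rewrite -(@eqrXn2 _ 2)// expr1n -s1.
have [g gP] := choice vio.
have g_0 : g @ \oo --> (0 : H).
  apply/cvg_seqP => e e0; have [N hN] := inv_nat_lt e0.
  exists N => n /hN nN; rewrite subr0; have [gn _] := gP n.
  exact: le_trans gn (ltW nN).
have [e e0 he] := @std_normal_away0 R.
have := ctsX _ _ g_0 e e0.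
set u := fun n => _; have -> : u = cst (normal_prob 0 1 (outside e)).
  apply/funext => n; rewrite /u /=.
  have [_ Xn] := gP n.
  have [Z ZE] : exists Z : {RV P >-> R}, forall w, Z w = X (g n) w - X 0 w.
    by apply: is_mfunP; exact: measurable_funB.
  have Zn : scaled_normal Z 1.
    by apply: scaled_normal_ae_eq Xn; apply: filterS field0 => w X0;
      rewrite ZE X0 subr0.
  transitivity (P (Z @^-1` outside e)).
    by congr (P _); apply/seteqP; split => w; rewrite /= /outside/= ZE.
  rewrite Zn; last exact: measurable_outside.
  by congr normal_prob; apply/seteqP; split => x; rewrite /= mul1r.
move=> c; move: he; rewrite lt0e => /andP[/eqP he _]; apply: he.
exact: (cvg_unique _ (cvg_cst _) c).
Qed.

Lemma gaussian_field_covariance :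
  exists A : {linear H -> H}, covariance_operator X A.
Proof.
have [C C0 XC] := gaussian_field_bounded.
have [|||A [bA AE]] :=
    @riesz_operator R H (fun f g => moment P (X f) (X g)) C.
- by move=> f g; rewrite momentC.
- move=> a f g h.
  by have := field_moment_lin a 1 f g (sX h); rewrite scale1r mul1r.
- move=> f g; rewrite -ler_sqr ?nnegrE ?mulr_ge0//.
  rewrite real_normK ?num_real// (le_trans (moment_le (sX f) (sX g)))//.
  rewrite !exprMn expr2 -mulrA mulrACA.
  by rewrite [leRHS](_ : _ = (C * `|f| ^+ 2) * (C * `|g| ^+ 2)) ?ler_pM ?moment_ge0//; ring.
exists A; split => //.
- by move=> f g; rewrite AE momentC -AE dotC.
- by move=> f g; rewrite expectation_moment// AE.
Qed.

Lemma covariance_moment (A : {linear H -> H}) f g :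
  covariance_operator X A -> moment P (X f) (X g) = '[A f, g].
Proof.
by case=> _ _ /(_ f g); rewrite expectation_moment// => -[].
Qed.

End Covariance.

(** An isometry from a dense set of vectors into Gaussian variables extends to a
   white noise. The value at [g] is the almost sure limit of [V (a n)] along
   vectors [T (a n)] that approach [g] geometrically; all moments pass to the
   limit. Linear relations between the variables are read off the moments: a
   combination whose second moment is 0 vanishes almost surely. *)
Lemma white_noise_extension (D : Type) (T : D -> H) (V : D -> {RV P >-> R}) :
    (forall a, zero_mean_gaussian (V a)) ->
    (forall a b, moment P (V a) (V b) = '[T a, T b]) ->
    (forall g (e : R), 0 < e -> exists a, `|T a - g| <= e) ->
  exists2 B : H -> {RV P >-> R}, white_noise B &
    forall a, {ae P, forall w, V a w = B (T a) w}.
Proof.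
move=> gV momV denseT.
have sV a : square_integrable P (V a).
  exact: zero_mean_gaussian_square_integrable.
have sub_moment (X Y : {RV P >-> R}) : square_integrable P X ->
    square_integrable P Y ->
    [/\ square_integrable P (fun w => X w - Y w) &
      moment P (fun w => X w - Y w) (fun w => X w - Y w) =
      moment P X X - 2 * moment P X Y + moment P Y Y].
  move=> sX sY.
  have -> : (fun w => X w - Y w) = (fun w => 1 * X w + (-1) * Y w).
    by apply/funext => w; rewrite mul1r mulN1r.
  split; first exact: square_integrable_lin.
  by rewrite moment_sqr//; ring.
have dist_V a b : (\int[P]_w ((V a w - V b w) ^+ 2)%:E = (`|T a - T b| ^+ 2)%:E)%E.
  have [s m] := sub_moment _ _ (sV a) (sV b).
  by rewrite integral_sqr// m !momV normB_sqr !hilbert_normE.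
have approx g : exists Y : {RV P >-> R}, exists a : nat -> D,
    [/\ forall n, `|T (a n) - g| <= 2^-1 ^+ n.+1,
        {ae P, forall w, V (a n) w @[n --> \oo] --> Y w} &
        forall n, (\int[P]_w ((Y w - V (a n) w) ^+ 2)%:E <=
                   ((2^-1 ^+ n) ^+ 2)%:E)%E].
  have /choice[a aP] : forall n : nat, exists x : D, `|T x - g| <= 2^-1 ^+ n.+1.
    by move=> n; apply: denseT; exact: exprn_gt0.
  have [|Y [Y1 Y2]] := @fast_L2_cauchy_limit _ _ _ P (fun n => V (a n)).
    move=> n m nm; rewrite dist_V lee_fin ler_sqr ?nnegrE ?exprn_ge0//.
    have -> : T (a m) - T (a n) = (T (a m) - g) - (T (a n) - g).
      by rewrite opprB addrA subrK.
    rewrite (le_trans (ler_normB _ _))//.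
    have le_mn : 2^-1 ^+ m.+1 <= 2^-1 ^+ n.+1 :> R.
      by rewrite ler_wiXn2l// invf_le1// ler1n.
    have := aP m; have := aP n.
    have -> : 2^-1 ^+ n = 2 * 2^-1 ^+ n.+1 :> R by rewrite exprS mulrA mulfV ?mul1r.
    lra.
  by exists Y, a.
have [B BP] := choice approx; have [a aP] := choice BP.
have half_cvg : (2^-1 : R) ^+ n @[n --> \oo] --> (0 : R).
  by apply: cvg_expr; rewrite ger0_norm ?invr_ge0// invf_lt1// ltr1n.
have T_cvg g : T (a g n) @[n --> \oo] --> g.
  apply/cvg_seqP => e e0.
  have /cvg_seqP/(_ e e0)[N hN] := half_cvg.
  exists N => n Nn; have [+ _ _] := aP g => /(_ n) /le_trans; apply.
  have := hN n.+1 (leqW Nn); rewrite subr0 ger0_norm//.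
have mBV g n : measurable_fun setT (fun w => B g w - V (a g n) w).
  exact: measurable_funB.
have sBV g n : square_integrable P (fun w => B g w - V (a g n) w).
  split => //; apply/integrableP; split.
    by apply/measurable_EFinP; exact: measurable_funX.
  under eq_integral do rewrite gee0_abs ?lee_fin ?sqr_ge0//.
  by have [_ _ /(_ n) /le_lt_trans] := aP g; apply; exact: ltry.
have sB g : square_integrable P (B g).
  have -> : (B g : Omega -> R) =
      (fun w => 1 * (B g w - V (a g 0) w) + 1 * V (a g 0) w).
    by apply/funext => w; rewrite !mul1r subrK.
  exact: square_integrable_lin.
have moment_cvg g (Z : {RV P >-> R}) : square_integrable P Z ->
    moment P (V (a g n)) Z @[n --> \oo] --> moment P (B g) Z.
  move=> sZ; apply/cvg_seqP => e e0.
  have z1 : 0 < Num.sqrt (moment P Z Z) + 1 by rewrite ltr_wpDl.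
  have /cvg_seqP/(_ (e / (Num.sqrt (moment P Z Z) + 1)))[|N hN] := half_cvg.
    by rewrite divr_gt0.
  exists N => n /hN; rewrite subr0 ger0_norm// => hn.
  have -> : moment P (V (a g n)) Z - moment P (B g) Z =
      - moment P (fun w => 1 * B g w + (-1) * V (a g n) w) Z.
    by rewrite moment_linl//; ring.
  rewrite (_ : (fun w => _) = (fun w => B g w - V (a g n) w)); last first.
    by apply/funext => w; rewrite mul1r mulN1r.
  apply: (@le_trans _ _ (2^-1 ^+ n * Num.sqrt (moment P Z Z))).
    rewrite normrN -ler_sqr ?nnegrE ?mulr_ge0//.
    rewrite real_normK ?num_real// exprMn sqr_sqrtr ?moment_ge0//.
    rewrite (le_trans (moment_le (sBV g n) sZ))// ler_wpM2r ?moment_ge0//.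
    by rewrite -lee_fin -integral_sqr//; have [_ _] := aP g.
  move: hn; rewrite ler_pdivlMr// => /(le_trans _); apply.
  by rewrite ler_wpM2l// lerDl.
have momBV g b : moment P (B g) (V b) = '[g, T b].
  have c : moment P (V (a g n)) (V b) @[n --> \oo] --> '[g, T b].
    rewrite (_ : (fun n => _) = fun n => '[T (a g n), T b]); first exact: cvg_dotl.
    by apply/funext => n; exact: momV.
  exact: (cvg_unique _ (moment_cvg g (V b) (sV b)) c).
have momBB g h : moment P (B g) (B h) = '[g, h].
  have c : moment P (V (a g n)) (B h) @[n --> \oo] --> '[g, h].
    rewrite (_ : (fun n => _) = fun n => '[T (a g n), h]); first exact: cvg_dotl.
    by apply/funext => n; rewrite momentC momBV dotC.
  exact: (cvg_unique _ (moment_cvg g (B h) (sB h)) c).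
have dist_B f g : moment P (fun w => B f w - B g w) (fun w => B f w - B g w) =
    `|f - g| ^+ 2.
  have [_ ->] := sub_moment _ _ (sB f) (sB g).
  by rewrite !momBB normB_sqr !hilbert_normE.
exists B; last first.
  move=> b; have [s m] := sub_moment _ _ (sV b) (sB (T b)).
  have := moment_eq0 s; rewrite m momV momBB momentC momBV => /(_ _)/wrap[].
    by ring.
  by apply: filterS => w /subr0_eq.
split; last first.
  split=> [|f g //|f g]; last by rewrite expectation_moment// momBB.
  by exists 1 => f; rewrite mul1r.
split.
- move=> g; apply/zero_mean_gaussianP.
  exists (Num.sqrt ('[g, g] / std_var)) => //.
  have [_ aB _] := aP g.
  apply: (@scaled_normal_limit _ _ _ P (fun n => V (a g n)) _
    (fun n => Num.sqrt (`|T (a g n)| ^+ 2 / std_var))) => //.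
    move=> n; rewrite hilbert_normE -momV; exact: gaussian_scale.
  have c : `|T (a g n)| @[n --> \oo] --> `|g| by apply: cvg_norm; exact: T_cvg.
  have c2 : `|T (a g n)| ^+ 2 / std_var @[n --> \oo] --> '[g, g] / std_var.
    rewrite -hilbert_normE; apply: cvgM; last exact: cvg_cst.
    by rewrite expr2; under eq_fun do rewrite expr2; exact: cvgM.
  exact: (cvg_comp _ _ c2 (@sqrt_continuous R _)).
- move=> x y f g.
  have s2 := square_integrable_lin x y (sB f) (sB g).
  have s3 := square_integrable_lin 1 (-1) (sB (x *: f + y *: g)) s2.
  have := moment_eq0 s3; rewrite moment_sqr// moment_linr// moment_sqr// !momBB.
  rewrite !(dotDl, dotDr, dotZl, dotZr) (dotC g f) => /(_ _)/wrap[].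
    by ring.
  apply: filterS => w; rewrite mul1r mulN1r; exact: subr0_eq.
- move=> u f uf e e0.
  have c : `|u n - f| @[n --> \oo] --> `|f - f|.
    by apply: cvg_norm; apply: cvgB => //; exact: cvg_cst.
  have c2 : (`|u n - f| ^+ 2 / e ^+ 2)%:E @[n --> \oo] --> 0%E.
    apply: cvg_EFin; first exact: nearW.
    rewrite -[X in _ --> X](mul0r (e ^+ 2)^-1); apply: cvgM; last exact: cvg_cst.
    rewrite [X in _ --> X](_ : 0 = `|f - f| * `|f - f|); last first.
      by rewrite subrr normr0 mulr0.
    exact: cvgM.
  apply: (squeeze_cvge _ (cvg_cst 0%E) c2); apply: nearW => n.
  rewrite measure_ge0/= -dist_B; apply: chebyshev_moment => //.
  by have [] := sub_moment _ _ (sB (u n)) (sB f).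
Qed.

(** The second moment of the Gaussian sum is the sum of the second moments, so the
   cross term vanishes. *)
Lemma independent_moment0 (X W Z : {RV P >-> R}) :
    zero_mean_gaussian X -> zero_mean_gaussian W ->
    (forall A B : set R, measurable A -> measurable B ->
       P ((X @^-1` A) `&` (W @^-1` B)) = (P (X @^-1` A) * P (W @^-1` B))%E) ->
    (forall w, Z w = X w + W w) ->
  zero_mean_gaussian Z /\ moment P X W = 0.
Proof.
move=> gX gW indep ZE.
have sX := zero_mean_gaussian_square_integrable gX.
have sW := zero_mean_gaussian_square_integrable gW.
have /zero_mean_gaussianP[s s0 Xs] := gX.
have /zero_mean_gaussianP[t t0 Wt] := gW.
have Zr := scaled_normal_add s0 t0 Xs Wt indep ZE.
split; first by apply/zero_mean_gaussianP; exists (Num.sqrt (s ^+ 2 + t ^+ 2)).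
have := scaled_normal_moment Zr.
rewrite sqr_sqrtr ?addr_ge0 ?sqr_ge0// mulrDl.
rewrite -(scaled_normal_moment Xs) -(scaled_normal_moment Wt).
have -> : (Z : Omega -> R) = (fun w => 1 * X w + 1 * W w).
  by apply/funext => w; rewrite !mul1r ZE.
by rewrite moment_sqr//; lra.
Qed.

Lemma independent_fields_preimage (X W : H -> {RV P >-> R}) f g :
    independent_fields X W ->
  forall A B : set R, measurable A -> measurable B ->
    P ((X f @^-1` A) `&` (W g @^-1` B)) = (P (X f @^-1` A) * P (W g @^-1` B))%E.
Proof.
move=> indep A B mA mB; apply: indep; apply: sub_gen_smallest.
  by exists f => //; exists A => //; rewrite setTI.
by exists g => //; exists B => //; rewrite setTI.
Qed.

End GaussianFields.

(** * White noise representations *)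

Section MainProof.
Context {R : realType} {d : measure_display} {Omega : measurableType d}.
Variable P : probability Omega R.
Variable H : hilbertSpace R.

(** A square root of the covariance makes [S f |-> X f] an isometry: [X f] has the
   moments that a white noise would have at [S f]. *)
Lemma covariance_sqrt (X : H -> {RV P >-> R}) (A : {linear H -> H}) :
    gaussian_field X -> covariance_operator X A ->
  exists S : {linear H -> H},
    [/\ bounded_operator S, adjoint_operators S S, forall x, S (S x) = A x &
        forall f g, moment P (X f) (X g) = '[S f, S g]].
Proof.
move=> fX cA; have [bA symA _] := cA.
have [|S [bS symS SS]] := positive_operator_sqrt bA symA.
  by move=> x; rewrite -(covariance_moment fX x x cA) moment_ge0.
exists S; split=> // f g.
by rewrite (covariance_moment fX f g cA) -SS symS.
Qed.

Lemma cvg_dense (D : Type) (T : D -> H) (u : nat -> D) (g : H) :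
  T (u n) @[n --> \oo] --> g -> forall e : R, 0 < e -> exists a, `|T a - g| <= e.
Proof. by move=> /cvg_seqP h e /h[N hN]; exists (u N); exact: hN. Qed.

(** Values of [X] only determine a noise on the closure of the range of [S]. The
   independent noise [W] supplies the missing directions, which by
   self-adjointness are those of the kernel of [S]. *)
Lemma gaussian_field_factorization (X : H -> {RV P >-> R}) :
    gaussian_field X -> carries_independent_white_noise X ->
  exists (K Kstar : {linear H -> H}) (B : H -> {RV P >-> R}),
    [/\ bounded_operator K, adjoint_operators K Kstar, white_noise B,
        covariance_operator X (K \o Kstar)
      & forall f : H, {ae P, forall w, X f w = B (Kstar f) w}].
Proof.
move=> fX [W [fW cW] indep].
have [A cA] := gaussian_field_covariance fX.
have [S [bS symS SS momX]] := covariance_sqrt fX cA.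
have [gX _ _] := fX; have [gW _ _] := fW.
have momW f g : moment P (W f) (W g) = '[f, g].
  exact: (covariance_moment fW f g cW).
have sX f := zero_mean_gaussian_square_integrable (gX f).
have sW f := zero_mean_gaussian_square_integrable (gW f).
(* Pairs (f, h) with [h] in the kernel of [S] index the vectors [S f + h]. *)
pose D := {p : H * H | S p.2 = 0}.
have /choice[V VE] : forall p : D, exists Z : {RV P >-> R},
    forall w, Z w = X (sval p).1 w + W (sval p).2 w.
  by move=> p; apply: is_mfunP; exact: measurable_funD.
have XW f g : moment P (X f) (W g) = 0.
  have [Z ZE] : exists Z : {RV P >-> R}, forall w, Z w = X f w + W g w.
    by apply: is_mfunP; exact: measurable_funD.
  exact: (independent_moment0 (gX f) (gW g) (independent_fields_preimage f g indep) ZE).2.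
have [|||B wB BE] :=
    @white_noise_extension _ _ _ P H D (fun p => S (sval p).1 + (sval p).2) V.
- move=> p; exact: (independent_moment0 (gX _) (gW _)
    (independent_fields_preimage _ _ indep) (VE p)).1.
- move=> p q.
  have VE' r : (V r : Omega -> R) =
      (fun w => 1 * X (sval r).1 w + 1 * W (sval r).2 w).
    by apply/funext => w; rewrite !mul1r VE.
  rewrite !VE' moment_linl//; last exact: square_integrable_lin.
  rewrite !moment_linr// momX momW XW (momentC P (W _)) XW.
  case: p q => [[f h] /= Sh] [[f' h'] /= Sh'].
  have orth x y : S y = 0 -> '[S x, y] = 0.
    by move=> Sy; rewrite symS Sy dotC dot0l.
  by rewrite dotDl !dotDr (orth _ _ Sh') (dotC h (S f')) (orth _ _ Sh); ring.
- move=> g; have [q [Sq [u ug]]] := kernel_projection symS g.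
  apply: (@cvg_dense D _ (fun n => exist _ (u n, q) Sq)) => /=.
  rewrite -[X in _ --> X](subrK q); apply: cvgD => //; exact: cvg_cst.
exists S, S, B; split=> //.
- have [bA symA AE] := cA.
  split.
  + by have [M bM] := bA; exists M => f /=; rewrite SS.
  + by move=> f g /=; rewrite !SS.
  + by move=> f g /=; rewrite SS.
- move=> f; pose p : D := exist _ (f, 0) (linear0 S).
  have W0 : {ae P, forall w, W 0 w = 0}.
    exact: field0 fW.
  have := BE p; rewrite /= addr0; apply: filterS2 W0 => w W0w.
  by rewrite VE /= W0w addr0.
Qed.

(** The extended space is [H] itself, with [H] embedded through the square root
   [S] of the covariance: the image is dense since [S] is injective and
   self-adjoint, so completing [H] for the norm [|S f|] gives a copy of [H]. *)
Lemma nondegenerate_field_extension (X : H -> {RV P >-> R}) :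
    gaussian_field X -> nondegenerate_field X ->
  exists (HR : hilbertSpace R) (i : {linear H -> HR}),
    continuous_embedding i /\
    exists2 B : HR -> {RV P >-> R}, white_noise B &
      forall f : H, {ae P, forall w, B (i f) w = X f w}.
Proof.
move=> fX [A cA injA].
have [S [bS symS SS momX]] := covariance_sqrt fX cA.
have S_inj0 f : S f = 0 -> f = 0.
  by move=> Sf; apply: injA; rewrite -SS Sf linear0.
have [gX _ _] := fX.
exists H, S; split.
  split=> // f g Sfg; apply: subr0_eq; apply: S_inj0.
  by rewrite linearB Sfg subrr.
have [|||B wB BE] := @white_noise_extension _ _ _ P H H S X => //.
- move=> g; have [q [Sq [u ug]]] := kernel_projection symS g.
  apply: (@cvg_dense H _ u); move: ug; rewrite (S_inj0 _ Sq) subr0; exact.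
- by exists B => // f; apply: filterS (BE f) => w ->.
Qed.

End MainProof.

Theorem theorem4 (R : realType) (d : measure_display)
    (Omega : measurableType d) (P : probability Omega R) :
  (forall (H : hilbertSpace R) (X : H -> {RV P >-> R}),
     gaussian_field X -> carries_independent_white_noise X ->
     exists (K Kstar : {linear H -> H}) (B : H -> {RV P >-> R}),
       [/\ bounded_operator K, adjoint_operators K Kstar, white_noise B,
           covariance_operator X (K \o Kstar)
         & forall f : H, {ae P, forall w, X f w = B (Kstar f) w}])
  /\
  (forall (H : hilbertSpace R) (X : H -> {RV P >-> R}),
     gaussian_field X -> nondegenerate_field X ->
     exists (HR : hilbertSpace R) (i : {linear H -> HR}),
       continuous_embedding i /\
       exists2 B : HR -> {RV P >-> R}, white_noise B &
         forall f : H, {ae P, forall w, B (i f) w = X f w}).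
Proof.
split=> H X.
- exact: gaussian_field_factorization.
- exact: nondegenerate_field_extension.
Qed.
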